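(* Consider the imitative monomer-dimer mean-field model with imitation coefficient $J>0$ and external field $h\in\mathbb{R}$, and let $\sigma$ be a random configuration in $\{0,1\}^n$ distributed according to the Gibbs measure $p(\sigma)$, with $m(\sigma)=n^{-1}(\sigma_1+\cdots+\sigma_n)$. (a) If $(J,h)\notin\Gamma\cup\{(J_c,h_c)\}$, then for $0\le z\le n^{1/6}$, $$\frac{\mathrm{P}(n^{1/2}(m(\sigma)-m_0)>z)}{\mathrm{P}(Z_0>z)}=1+O(1)n^{-1/2}(1+z^3),$$ where $Z_0$ is normally distributed with mean zero and variance $\lambda_0=-(H''(m_0))^{-1}-(2J)^{-1}$. (b) If $(J,h)=(J_c,h_c)$, then for $0\le z\le n^{1/20}$, $$\frac{\mathrm{P}(n^{1/4}(m(\sigma)-m_c)>z)}{\mathrm{P}(Y>z)}=1+O(1)n^{-1/4}(1+z^5),$$ where $Y$ has density $p(y)=c_1e^{-\lambda_cy^4/24}$, $y\in\mathbb{R}$, with $\lambda_c=-H^{(4)}(m_c)>0$ and $c_1$ the normalizing constant. In both cases $O(1)$ is bounded in absolute value by a constant not depending on $n$ or $z$.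
   Context: Let $V=\{1,\dots,n\}$ and let $E$ be the edge set of the complete graph on $V$. A dimer configuration is a set $D\subseteq E$ of pairwise nonincident edges (a matching); its set of monomers $\mathcal{M}(D)$ is the set of vertices not covered by any edge of $D$. For $\sigma\in\{0,1\}^n$ let $\mathcal{A}(\sigma)=\{i\in V:\sigma_i=1\}$ and let $D(\sigma)$ denote the number of dimer configurations $D$ with $\mathcal{M}(D)=\mathcal{A}(\sigma)$. Let $$-T(\sigma)=n\bigl(Jm(\sigma)^2+b\,m(\sigma)\bigr),\qquad b=\tfrac{\log n}{2}+h-J,\qquad m(\sigma)=n^{-1}(\sigma_1+\cdots+\sigma_n).$$ The Gibbs measure is $p(\sigma)=\dfrac{D(\sigma)\exp(-T(\sigma))}{\sum_{\tau\in\{0,1\}^n}D(\tau)\exp(-T(\tau))}$. Define $$g(x)=\tfrac12\bigl(\sqrt{e^{4x}+4e^{2x}}-e^{2x}\bigr),\qquad \tau(x)=(2x-1)J+h,$$ $$H(x)=-Jx^2-\tfrac12\Bigl(1-g(\tau(x))+\log\bigl(1-g(\tau(x))\bigr)\Bigr).$$ Let $J_c=\frac{1}{4(3-2\sqrt2)}$ and $h_c=\frac12\log(2\sqrt2-2)-\frac14$. Known facts fixing the notation: there is a function $\gamma$ on $[J_c,\infty)$ with $\gamma(J_c)=h_c$ such that, with $\Gamma=\{(J,\gamma(J)):J>J_c\}$, the function $H$ has a unique maximizer $m_0$ if $(J,h)\notin\Gamma$ (and then $m_0=g(\tau(m_0))$), whereas $H$ has two distinct maximizers if $(J,h)\in\Gamma$.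 If $(J,h)\notin\Gamma\cup\{(J_c,h_c)\}$ then $H''(m_0)<0$. If $(J,h)=(J_c,h_c)$ then $m_0=m_c:=2-\sqrt2$, $H'(m_c)=H''(m_c)=H^{(3)}(m_c)=0$ and $H^{(4)}(m_c)<0$. *)

(* Defs.v *)
From mathcomp Require Import all_boot all_order all_algebra.
From mathcomp Require Import all_classical all_reals all_analysis.

Set Implicit Arguments.
Unset Strict Implicit.
Unset Printing Implicit Defensive.

Import Order.TTheory GRing.Theory Num.Theory.
Import numFieldNormedType.Exports.

Local Open Scope classical_set_scope.
Local Open Scope ring_scope.

(** * Dimer configurations on the complete graph with vertex set ['I_n] *)

Definition edges (n : nat) : {set {set 'I_n}} :=
  [set e : {set 'I_n} | #|e| == 2%N]%SET.

Definition dimer_config (n : nat) (D : {set {set 'I_n}}) : bool :=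
  (D \subset edges n) && finset.trivIset D.

Definition monomers (n : nat) (D : {set {set 'I_n}}) : {set 'I_n} :=
  (~: finset.cover D)%SET.

(** [true] at [i] means [sigma_i = 1], i.e. [i] is a monomer. *)
Definition config (n : nat) := {ffun 'I_n -> bool}.

Definition monomer_sites (n : nat) (s : config n) : {set 'I_n} :=
  [set i | s i]%SET.

Definition dimer_count (n : nat) (s : config n) : nat :=
  #|[set D | dimer_config D & monomers D == monomer_sites s]%SET|.

(** * Gibbs measure *)

Definition magnetization (R : realType) (n : nat) (s : config n) : R :=
  n%:R^-1 * \sum_(i < n) (s i)%:R.

Definition field_b (R : realType) (n : nat) (J h : R) : R :=
  ln n%:R / 2 + h - J.

Definition hamiltonian (R : realType) (n : nat) (J h : R) (s : config n) : R :=
  - (n%:R * (J * magnetization R s ^+ 2 + field_b n J h * magnetization R s)).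

Definition gibbs_weight (R : realType) (n : nat) (J h : R) (s : config n) : R :=
  (dimer_count s)%:R * expR (- hamiltonian J h s).

Definition gibbs (R : realType) (n : nat) (J h : R) (s : config n) : R :=
  gibbs_weight J h s / \sum_(t : config n) gibbs_weight J h t.

Definition gibbs_prob (R : realType) (n : nat) (J h : R) (A : pred (config n)) : R :=
  \sum_(s | A s) gibbs J h s.

(** * The variational function and the critical point *)

Definition g (R : realType) (x : R) : R :=
  (Num.sqrt (expR (4 * x) + 4 * expR (2 * x)) - expR (2 * x)) / 2.

Definition tau (R : realType) (J h x : R) : R := (2 * x - 1) * J + h.

Definition H (R : realType) (J h x : R) : R :=
  - J * x ^+ 2 - (1 - g (tau J h x) + ln (1 - g (tau J h x))) / 2.

Definition J_crit (R : realType) : R := (4 * (3 - 2 * Num.sqrt 2))^-1.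

Definition h_crit (R : realType) : R := ln (2 * Num.sqrt 2 - 2) / 2 - 4^-1.

Definition m_crit (R : realType) : R := 2 - Num.sqrt 2.

Definition maximizer (R : realType) (f : R -> R) (m : R) : Prop :=
  forall x : R, f x <= f m.

(** Only the values of [gamma] on [[J_crit, +oo[] are relevant. *)
Definition Gamma (R : realType) (gamma : R -> R) : set (R * R) :=
  [set p | J_crit R < p.1 /\ p.2 = gamma p.1].

(** This determines [gamma] on [[J_crit, +oo[]: for [J > J_crit], [gamma J] is
    the only field at which [H J h] has more than one maximizer. *)
Definition coexistence_curve (R : realType) (gamma : R -> R) : Prop :=
  gamma (J_crit R) = h_crit R /\
  forall J h : R, 0 < J ->
    (~ Gamma gamma (J, h) -> exists! m : R, maximizer (H J h) m) /\
    (Gamma gamma (J, h) ->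
       exists m1 m2 : R,
         [/\ m1 <> m2, maximizer (H J h) m1 & maximizer (H J h) m2]).

(** * Limiting laws *)

Definition lambda0 (R : realType) (J h m0 : R) : R :=
  - (derive1n 2 (H J h) m0)^-1 - (2 * J)^-1.

Definition lambda_crit (R : realType) : R :=
  - derive1n 4 (H (J_crit R) (h_crit R)) (m_crit R).

(** [P(Z > z)] for [Z] centered normal of variance [v]; the second parameter of
    [normal_prob] is the standard deviation. *)
Definition normal_tail (R : realType) (v z : R) : R :=
  fine (normal_prob 0 (Num.sqrt v) `]z, +oo[).

Definition quartic_fun (R : realType) (l y : R) : R :=
  expR (- (l * y ^+ 4 / 24)).

Definition quartic_pdf (R : realType) (l y : R) : R :=
  (Rintegral (@lebesgue_measure R) setT (quartic_fun l))^-1 * quartic_fun l y.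

Definition quartic_tail (R : realType) (l z : R) : R :=
  Rintegral (@lebesgue_measure R) `]z, +oo[ (quartic_pdf l).

(* Main.v *)
Require Import Defs.
From mathcomp Require Import all_boot all_order all_algebra.
From mathcomp Require Import all_classical all_reals all_analysis.
From mathcomp Require Import measurable_realfun ring lra zify.

(** The magnetization is [k / n], where [k] is the number of monomers, and a
    configuration with [d] dimers has [k = n - 2d]. Counting perfect matchings of
    the [2d] covered sites shows that [d] has a law proportional to
    [n! / (k! d! 2^d) * exp (J k^2 / n + b k)] ([gibbs_probE]). Writing
    [b_k = ln (k! / (k/e)^k)], this weight equals exactly
    [exp (n f(k/n) - b_k - b_d)] up to a factor independent of [d], where [f] is
    the explicit function [free_energy] ([monomer_dimer_weightE]). The increments
    of [b_k] lie between [0] and [1/(k+1)], so that these corrections are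
    nearly constant around the maximum of [f] and only contribute to the error.

    The function [H] is linked to [f] by Legendre duality:
    [H y + 1] is the maximum over [x] of [f x - J (x - y)^2]. Therefore a
    maximizer of [H] also maximizes [f] ([H_maximizer]), and away from the unique maximizer
    [m] the function [f] stays below its maximum by a positive amount
    ([free_energy_gap]). The derivatives of [f] are rational from the second on.
    If [f''(m) = 0] at a maximum then [f'''(m) = 0], which forces [m = 2 - sqrt 2]
    and then [(J, h)] to be the critical point ([H_critical_point]). So in case (a)
    [f''(m) < 0], and the variance [lambda0] is [- 1 / f''(m)] ([lambda0E]); in
    case (b) the first nonzero term of the expansion of [f] at [m] has order four,
    with coefficient [- lambda_crit / 24] ([lambda_critE]).

    Both cases are then instances of one Laplace estimate, with [r = 2] or
    [r = 4]. Put [X = n ^ (1/r)] and [y = X (k/n - m)]. Up to a common factor, the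
    weight at [y] is [D exp (- c |y|^r + E)], where [D = 2 X / n] is the spacing of
    the values of [y] and [E = O((1 + |y|^(r+1)) / X)] for [|y| <= e X]
    ([weight_bulk]); it is exponentially small for larger [|y|] ([weight_far]).
    The sum of these weights over [y > z] is compared with the integral of
    [exp (- c y^r)] over the same range ([lattice_tail]), where [c] is
    [1 / (2 lambda0)] or [lambda_crit / 24]. Since this integral is at
    least of order [exp (- c z^r) / (1 + z^(r-1))] ([tail_minorant]), and since
    after the exponent [E] is taken into account the terms still decrease in
    [y - z] at an exponential rate proportional to [1 + z^(r-1)], the error is
    [O((1 + z^(r+1)) / X)] relative to the integral as long as [z^(r+1) <= X],
    which is the range of the theorem. The same estimate with [z = 0], applied to
    both half lines, gives the normalizing constant ([scaled_weight_sums]), and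
    the ratio follows ([gibbs_tail_ratio]). *)

Set Implicit Arguments.
Unset Strict Implicit.

Import Order.TTheory GRing.Theory Num.Theory.
Import numFieldNormedType.Exports.

Local Open Scope classical_set_scope.
Local Open Scope ring_scope.

(** * Matchings of the complete graph and the Gibbs weights *)

Definition matchings_of (n : nat) (B : {set 'I_n}) : {set {set {set 'I_n}}} :=
  [set D | dimer_config D & finset.cover D == B]%SET.

Lemma card_matchings0 (n : nat) : #|matchings_of (n := n) finset.set0| = 1%N.
Proof.
rewrite (_ : matchings_of _ = [set finset.set0]%SET) ?cards1 //.
apply/setP => D; rewrite !inE; apply/idP/idP.
- case/andP=> /andP[/fintype.subsetP sD _] /eqP cD; apply/eqP/setP => e; rewrite inE.
  apply/negbTE/negP => eD; have := sD _ eD; rewrite inE => /eqP e2.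
  have : e \subset finset.cover D by apply: finset.bigcup_sup.
  by rewrite cD finset.subset0 => /eqP e0; rewrite e0 cards0 in e2.
- move/eqP->; rewrite /dimer_config finset.sub0set /finset.cover !big_set0 eqxx andbT.
  by apply/finset.trivIsetP => A B; rewrite inE.
Qed.

Lemma dimer_pair (n : nat) (D : {set {set 'I_n}}) (B : {set 'I_n}) (x : 'I_n) :
  D \in matchings_of B -> x \in B ->
  exists2 y, y \in (B :\ x)%SET & [set x; y]%SET \in D.
Proof.
rewrite inE => /andP[/andP[/fintype.subsetP sD tD] /eqP cD] xB.
have /finset.bigcupP[e eD xe] : x \in finset.cover D by rewrite cD.
have := sD _ eD; rewrite inE => /cards2P[a [b [ab ee]]].
have eB : e \subset B by rewrite -cD; apply: finset.bigcup_sup.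
move: xe; rewrite ee !inE => /orP[]/eqP xe.
- exists b; last by rewrite xe -ee.
  rewrite !inE xe eq_sym ab /=; apply: (fintype.subsetP eB).
  by rewrite ee !inE eqxx orbT.
- exists a; last by rewrite xe finset.setUC -ee.
  rewrite !inE xe ab /=; apply: (fintype.subsetP eB).
  by rewrite ee !inE eqxx.
Qed.

Lemma dimer_unique (n : nat) (D : {set {set 'I_n}}) (B : {set 'I_n}) (e e' : {set 'I_n}) x :
  D \in matchings_of B -> e \in D -> e' \in D -> x \in e -> x \in e' -> e = e'.
Proof.
rewrite inE => /andP[/andP[_ /finset.trivIsetP tD] _] eD e'D xe xe'.
apply/eqP; apply/negPn/negP => ne; have := tD _ _ eD e'D ne.
by move/disjointFr => /(_ x xe); rewrite xe'.
Qed.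

(** Deleting the edge [{x, y}] is a bijection from the perfect matchings of [B]
    that use it onto the perfect matchings of [B] without [x] and [y]. *)
Lemma card_matchings_through (n : nat) (B : {set 'I_n}) (x y : 'I_n) :
  x \in B -> y \in (B :\ x)%SET ->
  #|[set D in matchings_of B | [set x; y]%SET \in D]%SET| =
  #|matchings_of (B :\ x :\ y)%SET|.
Proof.
move=> xB; rewrite !inE => /andP[yx yB].
set e := [set x; y]%SET.
have ecard : #|e| = 2%N by rewrite cards2 eq_sym yx.
have xe : x \in e by rewrite !inE eqxx.
have ye : y \in e by rewrite !inE eqxx orbT.
pose F (D : {set {set 'I_n}}) := (D :\ e)%SET.
have Finj : {in [set D in matchings_of B | e \in D]%SET &, injective F}.
  move=> D D'; rewrite !inE => /andP[_ eD] /andP[_ eD'] FF.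
  by rewrite -(finset.setD1K eD) -(finset.setD1K eD') -/(F _) -/(F D') FF.
rewrite -(card_in_imset Finj); congr #|pred_of_set _|; apply/setP => D.
apply/imsetP/idP => [[D0]|DM].
- rewrite inE => /andP[D0M eD0] ->; move: (D0M); rewrite inE.
  case/andP=> /andP[sD tD] /eqP cD.
  rewrite inE /dimer_config (fintype.subset_trans (finset.subsetDl _ _) sD) /=.
  have tF : finset.trivIset (F D0) by apply: (finset.trivIsetS (finset.subsetDl _ _)).
  rewrite tF /=; apply/eqP/setP => z; rewrite !inE; apply/finset.bigcupP/idP.
  + case=> e'; rewrite !inE => /andP[e'e e'D] ze'.
    have ne w : w \in e -> z != w.
      move=> we; apply: contra e'e => /eqP zw; rewrite zw in ze'.
      by apply/eqP; apply: (dimer_unique D0M e'D eD0 ze' we).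
    rewrite ne // ne //= -cD; apply/finset.bigcupP; by exists e'.
  + case/and3P=> zy zx; rewrite -cD => /finset.bigcupP[e' e'D ze']; exists e' => //.
    rewrite !inE e'D andbT; apply: contraTneq ze' => ->.
    by rewrite !inE negb_or zx zy.
- move: (DM); rewrite inE => /andP[/andP[sD tD] /eqP cD].
  have eND : e \notin D.
    apply/negP => eD; have : x \in finset.cover D by apply/finset.bigcupP; exists e.
    by rewrite cD !inE eqxx andbF.
  exists (e |: D)%SET; last by rewrite /F finset.setU1K.
  rewrite !inE eqxx /= andbT /dimer_config; apply/andP; split; first (apply/andP; split).
  + by rewrite finset.subUset sD andbT finset.sub1set inE ecard.
  + apply/finset.trivIsetP => a b.
    have dis a' : a' \in D -> fintype.disjoint (mem e) (mem a').
      move=> aD; have sa : a' \subset (B :\ x :\ y)%SET.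
        by rewrite -cD; apply: finset.bigcup_sup.
      apply/pred0P => w /=; apply/negbTE/negP; rewrite !inE => /andP[we wa].
      have := fintype.subsetP sa _ wa; rewrite !inE => /and3P[/negbTE wy /negbTE wx _].
      by rewrite wx wy in we.
    rewrite !inE => /orP[/eqP->|aD] /orP[/eqP->|bD]; rewrite ?eqxx // => ab.
    * by apply: dis.
    * by rewrite disjoint_sym; apply: dis.
    * by move/finset.trivIsetP: tD; apply.
  + have -> : finset.cover (e |: D)%SET = (e :|: finset.cover D)%SET.
      by rewrite /finset.cover finset.bigcup_setU finset.big_set1.
    rewrite cD; apply/eqP/setP => z; rewrite !inE.
    have [->|] := eqVneq z x; first by rewrite xB.
    by have [->|] := eqVneq z y; rewrite ?yB //= ?andbT.
Qed.

(** The partner [y] of the fixed site [x] is unique, so the matchings of [B] are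
    sorted by it. *)
Lemma card_matchings_rec (n : nat) (B : {set 'I_n}) (x : 'I_n) : x \in B ->
  #|matchings_of B| = (\sum_(y in (B :\ x)%SET) #|matchings_of (B :\ x :\ y)%SET|)%N.
Proof.
move=> xB; under eq_bigr => y yB do rewrite -(card_matchings_through xB yB).
rewrite -sum1_card.
under [RHS]eq_bigr => y yB do rewrite -sum1_card.
rewrite (exchange_big_dep (mem (matchings_of B))) /=; last first.
  by move=> y D _; rewrite inE => /andP[].
apply: eq_bigr => D DM; rewrite sum1_card.
have [y yB eD] := dimer_pair DM xB.
rewrite (eq_card (B := pred1 y)) ?card1 // => z; rewrite [RHS]inE unfold_in.
apply/andP/eqP => [[zB]|->]; last by split=> //; rewrite inE DM.
rewrite inE => /andP[_ zD].
have /setP/(_ z) := dimer_unique (x := x) DM zD eD (set21 _ _) (set21 _ _).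
rewrite !inE eqxx orbT; move: zB; rewrite !inE => /andP[/negbTE -> _] /=.
by move=> /esym/eqP.
Qed.

(** The recursion gives [(2d - 1)!!], stated without division. *)
Lemma card_matchings (n d : nat) (B : {set 'I_n}) : #|B| = d.*2 ->
  (#|matchings_of B| * (2 ^ d * d`!) = (d.*2)`!)%N.
Proof.
elim: d B => [|d IH] B cB.
  by move/eqP: cB; rewrite cards_eq0 => /eqP ->; rewrite card_matchings0.
have /card_gt0P[x xB] : (0 < #|B|)%N by rewrite cB.
have cx : #|(B :\ x)%SET| = d.*2.+1 by move: (cardsD1 x B); rewrite xB cB; lia.
rewrite (card_matchings_rec xB) big_distrl /=.
rewrite (eq_bigr (fun=> (d.*2)`! * (2 * d.+1))%N); last first.
  move=> y yB; rewrite -(IH (B :\ x :\ y)%SET); last first.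
    by have := cardsD1 y (B :\ x)%SET; rewrite yB cx add1n => -[].
  by rewrite expnS factS -!mulnA; congr (_ * _)%N; rewrite mulnCA; congr (_ * _)%N; rewrite mulnA mulnC.
rewrite sum_nat_const cx doubleS !factS (_ : d.*2.+2 = 2 * d.+1)%N; last by lia.
by rewrite mulnCA [in RHS]mulnCA mulnC -!mulnA; congr (_ * _)%N; rewrite mulnCA.
Qed.

Lemma card_matchings_odd (n : nat) (B : {set 'I_n}) : odd #|B| -> #|matchings_of B| = 0%N.
Proof.
move=> oB; apply/eqP; rewrite cards_eq0; apply/set0Pn => -[D].
rewrite inE => /andP[/andP[/fintype.subsetP sD tD] /eqP cD].
move/eqP: tD; rewrite cD => tD; move: oB; rewrite -tD.
rewrite (eq_bigr (fun=> 2%N)) => [|e eD]; last by have := sD _ eD; rewrite inE => /eqP.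
by rewrite sum_nat_const oddM andbF.
Qed.

Lemma dimer_countE (n : nat) (s : config n) :
  dimer_count s = #|matchings_of (~: monomer_sites s)%SET|.
Proof.
rewrite /dimer_count; congr #|pred_of_set _|; apply/setP => D; rewrite !inE.
by rewrite /monomers -(inj_eq (inv_inj (@finset.setCK _))) finset.setCK.
Qed.

(** The total Gibbs weight of the configurations with [k] monomers and [d]
    dimers: [n! / (k! d! 2^d)] is ['C(n, k)] times the number of perfect
    matchings of the remaining [2d] sites. *)
Definition monomer_dimer_weight (R : realType) (J h : R) (n k d : nat) : R :=
  n`!%:R / (k`!%:R * (2 ^+ d * d`!%:R)) *
  expR (n%:R * (J * (k%:R / n%:R) ^+ 2 + field_b n J h * (k%:R / n%:R))).

Lemma magnetizationE (R : realType) (n : nat) (s : config n) :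
  magnetization R s = #|monomer_sites s|%:R / n%:R.
Proof.
rewrite /magnetization mulrC; congr (_ / _).
rewrite -sum1_card natr_sum [RHS]big_mkcond /=; apply: eq_bigr => i _.
by rewrite inE; case: (s i).
Qed.

Lemma sum_config (R : realType) (n : nat) (F : nat -> R) :
  \sum_(s : config n) F #|monomer_sites s| = \sum_(k < n.+1) 'C(n, k)%:R * F k.
Proof.
rewrite (reindex (fun A : {set 'I_n} => [ffun i => i \in A] : config n)) /=; last first.
  exists (fun s : config n => monomer_sites s) => [A _|s _].
    by apply/setP => i; rewrite !inE ffunE.
  by apply/ffunP => i; rewrite ffunE inE.
rewrite (partition_big (fun A : {set 'I_n} => inord #|A| : 'I_n.+1) xpredT) //=.
apply: eq_bigr => k _.
have sz (A : {set 'I_n}) : (#|A| < n.+1)%N by rewrite ltnS -[X in (_ <= X)%N](card_ord n) max_card.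
rewrite (eq_bigr (fun=> F k)); last first.
  move=> A /eqP <-; rewrite inordK //; congr (F #|pred_of_set _|).
  by apply/setP => i; rewrite !inE ffunE.
rewrite sumr_const -[LHS]mulr_natl; congr (_ %:R * _).
rewrite -[X in 'C(X, _)](card_ord n) -cardsT -cards_draws; apply: eq_card => A.
rewrite !inE finset.subsetT /= /in_mem /=.
by apply/eqP/eqP => [<-|->]; rewrite ?inordK ?inord_val.
Qed.

(** Dimers cover an even number of sites, so that the number of dimers is the
    natural summation index. *)
Lemma sum_even_part (R : realType) (n : nat) (F : nat -> R) :
  (forall k, (k <= n)%N -> odd (n - k) -> F k = 0) ->
  \sum_(k < n.+1) F k = \sum_(d < n./2.+1) F (n - d.*2)%N.
Proof.
move=> F0.
rewrite (big_ord_widen_cond n.+1 xpredT (fun d => F (n - d.*2)%N)); last by lia.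
under [RHS]eq_bigl => d do rewrite /=.
rewrite (bigID (fun k : 'I_n.+1 => odd (n - k))) /= big1 ?add0r; last first.
  by move=> k; apply: F0; rewrite -ltnS.
have lt1 (d : nat) : (n - d.*2 < n.+1)%N by lia.
have lt2 (k : nat) : ((n - k)./2 < n.+1)%N by lia.
rewrite (reindex_onto (fun d : 'I_n.+1 => Ordinal (lt1 d)) (fun k => Ordinal (lt2 k))) /=.
  apply: eq_bigl => d; apply/andP/idP => [[_ /eqP/(congr1 val) /=]|dl]; first lia.
  split; first lia. by apply/eqP/val_inj => /=; lia.
by move=> k ok; apply: val_inj => /=; move: (ltn_ord k); lia.
Qed.

Lemma gibbs_weight_sum (R : realType) (n : nat) (J h : R) (P : R -> bool) :
  \sum_(s : config n | P (magnetization R s)) gibbs_weight J h s =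
  \sum_(d < n./2.+1 | P ((n - d.*2)%:R / n%:R)) monomer_dimer_weight J h n (n - d.*2) d.
Proof.
pose M k := (if odd (n - k) then 0 else ((n - k)`!)%:R / (2 ^+ (n - k)./2 * ((n - k)./2)`!%:R)) : R.
pose F k := (if P (k%:R / n%:R) then
  M k * expR (n%:R * (J * (k%:R / n%:R) ^+ 2 + field_b n J h * (k%:R / n%:R))) else 0) : R.
rewrite big_mkcond /=.
rewrite (eq_bigr (fun s => F #|monomer_sites s|)); last first.
  move=> s _; rewrite magnetizationE /F; case: ifP => // _.
  rewrite /gibbs_weight /hamiltonian opprK magnetizationE; congr (_ * _).
  have cC : #|(~: monomer_sites s)%SET| = (n - #|monomer_sites s|)%N by rewrite cardsCs finset.setCK card_ord.
  rewrite dimer_countE /M; case: ifP => o; first by rewrite card_matchings_odd // cC.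
  have := @card_matchings n ((n - #|monomer_sites s|)./2) (~: monomer_sites s)%SET.
  rewrite cC even_halfK ?o // => /(_ erefl) <-.
  rewrite !natrM natrX mulfK // mulf_eq0 negb_or expf_neq0 ?pnatr_eq0 //=.
rewrite sum_config (@sum_even_part _ n (fun k => 'C(n, k)%:R * F k)); last first.
  by move=> k kn o; rewrite /F /M o mul0r if_same mulr0.
rewrite [RHS]big_mkcond /=; apply: eq_bigr => d _.
have dn : (d.*2 <= n)%N by move: (ltn_ord d); lia.
rewrite /F; case: ifP => _; last by rewrite mulr0.
rewrite /monomer_dimer_weight mulrA; congr (_ * _).
rewrite /M subKn // odd_double doubleK.
have := bin_fact (leq_subr d.*2 n); rewrite subKn // => E.
rewrite -E !natrM.
have nz m : (m`!)%:R != 0 :> R by rewrite pnatr_eq0 -lt0n fact_gt0.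
by field; rewrite !nz /= expf_neq0 // pnatr_eq0.
Qed.

(** The whole probability space reduces to the number [d] of dimers, and the
    normalization of the weights cancels from now on. *)
Lemma gibbs_probE (R : realType) (n : nat) (J h : R) (P : R -> bool) :
  gibbs_prob J h (fun s : config n => P (magnetization R s)) =
  (\sum_(d < n./2.+1 | P ((n - d.*2)%:R / n%:R)) monomer_dimer_weight J h n (n - d.*2) d) /
  (\sum_(d < n./2.+1) monomer_dimer_weight J h n (n - d.*2) d).
Proof.
rewrite /gibbs_prob /gibbs -mulr_suml gibbs_weight_sum; congr (_ / _).
exact: (gibbs_weight_sum n J h xpredT).
Qed.

(** * Tail sums over an arithmetic progression *)

(** Closes goals [0 <= t] for [t] built from sums, products, inverses, powers and
    exponentials; powers come before products, into which they unfold. *)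
Ltac nneg := repeat first [ done | apply: expR_ge0 | by apply: ltW | apply: exprn_ge0
  | apply: mulr_ge0 | rewrite invr_ge0 | apply: addr_ge0 ].

Section powers.
Variable R : realType.
Implicit Types (a c x z t u : R) (p m n : nat).

(** The two gains [t ^ r] and [z ^ (r-1) * t] of [(z + t) ^ r] over [z ^ r] give
    a Gaussian-type decay for large [t] and an exponential decay whose rate grows
    with [z]. *)
Lemma expr_superadd p z t : 0 <= z -> 0 <= t ->
  z ^+ p.+2 + t ^+ p.+2 + z ^+ p.+1 * t <= (z + t) ^+ p.+2.
Proof.
move=> z0 t0; elim: p => [|p IH]; first by have := mulr_ge0 z0 t0; rewrite !expr2 expr1; lra.
rewrite [leRHS]exprS.
apply: le_trans (ler_wpM2l (addr_ge0 z0 t0) IH).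
have h1 : 0 <= z ^+ p.+1 by apply: exprn_ge0.
have h2 : 0 <= t ^+ p.+1 by apply: exprn_ge0.
rewrite (exprS z p.+2) (exprS t p.+2) (exprS z p.+1) (exprS t p.+1).
have := mulr_ge0 (mulr_ge0 z0 t0) h2; have := mulr_ge0 (mulr_ge0 z0 t0) h1.
have := mulr_ge0 (mulr_ge0 t0 t0) h1; lra.
Qed.

(** Once multiplied by [1/X] with [t <= e * X], the increment of the error
    exponent is a small fraction of the increment of the main one. *)
Lemma expr_diff_le p z t : 0 <= z -> z <= t ->
  t ^+ p.+3 - z ^+ p.+3 <= 2 * t * (t ^+ p.+2 - z ^+ p.+2).
Proof.
move=> z0 zt; have := expr_superadd p z0 (_ : 0 <= t - z).
rewrite subr_ge0 => /(_ zt); rewrite (addrC z) subrK => hs.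
have h1 : 0 <= (t - z) ^+ p.+2 by apply: exprn_ge0; rewrite subr_ge0.
have h2 : 0 <= z ^+ p.+1 by apply: exprn_ge0.
rewrite (exprS t p.+2) (exprS z p.+2).
have h3 : z ^+ p.+2 = z * z ^+ p.+1 by rewrite exprS.
set T := t ^+ p.+2 in hs *; set W := z ^+ p.+2 in hs h3 *.
have hs' : z ^+ p.+1 * (t - z) <= T - W by lra.
have : z * (z ^+ p.+1 * (t - z)) <= t * (T - W).
  by apply: ler_pM => //; apply: mulr_ge0 => //; rewrite subr_ge0.
rewrite h3; nra.
Qed.

Lemma expr_lip m z x : 0 <= z -> z <= x -> x ^+ m.+1 - z ^+ m.+1 <= m.+1%:R * (x - z) * x ^+ m.
Proof.
move=> z0 zx; have x0 := le_trans z0 zx; elim: m => [|m IH]; first by rewrite !expr1 expr0; lra.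
have h1 : z ^+ m.+1 <= x ^+ m.+1 by apply: lerXn2r; rewrite ?nnegrE.
have h2 : 0 <= x ^+ m by apply: exprn_ge0.
rewrite (exprS x m.+1) (exprS z m.+1).
have -> : x * x ^+ m.+1 - z * z ^+ m.+1 = x * (x ^+ m.+1 - z ^+ m.+1) + (x - z) * z ^+ m.+1 by ring.
apply: (@le_trans _ _ (x * (m.+1%:R * (x - z) * x ^+ m) + (x - z) * x ^+ m.+1)).
  by apply: lerD; apply: ler_wpM2l => //; rewrite subr_ge0.
by rewrite exprS -[in leRHS]natr1 le_eqVlt; apply/orP; left; apply/eqP; ring.
Qed.

Lemma expr1D_le m z : 0 <= z -> (1 + z) ^+ m <= 2 ^+ m * (1 + z ^+ m).
Proof.
move=> z0; have zm : 0 <= z ^+ m by apply: exprn_ge0.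
have [z1|z1] := leP z 1.
- apply: (@le_trans _ _ (2 ^+ m)); first by apply: lerXn2r; rewrite ?nnegrE; lra.
  by rewrite ler_peMr ?exprn_ge0 //; lra.
- apply: (@le_trans _ _ ((2 * z) ^+ m)); first by apply: lerXn2r; rewrite ?nnegrE; lra.
  by rewrite exprMn ler_wpM2l ?exprn_ge0 //; lra.
Qed.

Lemma expr1D_ge m z : 0 <= z -> 1 + z ^+ m.+1 <= (1 + z) ^+ m.+1.
Proof.
move=> z0; elim: m => [|m IH]; first by rewrite !expr1.
rewrite [leRHS]exprS; apply: le_trans (ler_wpM2l _ IH); last lra.
have h : 0 <= z ^+ m.+1 by apply: exprn_ge0.
rewrite (exprS z); nra.
Qed.

Lemma expr1D_mul m z t : 0 <= z -> 0 <= t -> (1 + (z + t)) ^+ m <= (1 + z) ^+ m * (1 + t) ^+ m.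
Proof. by move=> z0 t0; rewrite -exprMn; apply: lerXn2r; rewrite ?nnegrE; nra. Qed.

Lemma expr_le_expR m z : 0 <= z -> z ^+ m <= expR (m%:R * z).
Proof.
move=> z0; rewrite mulrC expRM_natr; apply: lerXn2r; rewrite ?nnegrE ?expR_ge0 //.
by have := expR_ge1Dx z; lra.
Qed.

Lemma quad_le a b x : 0 < a -> b * x - a * x ^+ 2 <= b ^+ 2 / (4 * a).
Proof.
move=> a0; rewrite ler_pdivlMr; last by lra.
have : 0 <= (2 * a * x - b) ^+ 2 by apply: sqr_ge0.
rewrite !expr2; nra.
Qed.

(** Polynomial factors are absorbed by the decay, of which an exponential rate
    survives. *)
Lemma poly_gauss_le m p a : 0 < a -> exists2 K : R, 0 < K &
  forall t, 0 <= t -> (1 + t) ^+ m * expR (- (a * t ^+ p.+2)) <= K * expR (- (a * t)).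
Proof.
move=> a0; exists (expR (m%:R + a + (m%:R + a) ^+ 2 / (4 * a))); first exact: expR_gt0.
move=> t t0; have t1 : 0 <= 1 + t by lra.
apply: le_trans (ler_wpM2r (expR_ge0 _) (expr_le_expR m t1)) _.
rewrite -!expRD ler_expR.
have h := quad_le (m%:R + a) t a0.
have : a * (t ^+ 2 - 1) <= a * t ^+ p.+2.
  rewrite ler_pM2l //; have [lt1|gt1] := leP t 1.
    have := exprn_ge0 p.+2 t0; rewrite expr2; nra.
  have : t ^+ 2 * 1 <= t ^+ 2 * t ^+ p by rewrite ler_wpM2l ?exprn_ge0 // exprn_ege1 //; lra.
  by rewrite -exprD add2n; lra.
nra.
Qed.

(** Induction works because [expR (- a) * (1 + 1/a) <= 1/a], that is
    [1 + a <= expR a]. *)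
Lemma geometric_expR_le a N : 0 < a -> \sum_(i < N) expR (- (a * i%:R)) <= 1 + a^-1.
Proof.
move=> a0; elim: N => [|N IH]; first by rewrite big_ord0 addr_ge0 // invr_ge0 ltW.
rewrite big_ord_recl /= mulr0 oppr0 expR0 lerD2l.
under eq_bigr => i _ do rewrite /bump /= natrD mulrDr mulr1 opprD expRD.
rewrite -mulr_sumr.
apply: le_trans (ler_wpM2l (expR_ge0 _) IH) _.
have -> : 1 + a^-1 = (1 + a) / a by field; rewrite gt_eqF.
rewrite mulrA -[leRHS]mul1r ler_wpM2r ?invr_ge0 ?(ltW a0) //.
rewrite expRN mulrC ler_pdivrMr ?expR_gt0 // mul1r; exact: expR_ge1Dx.
Qed.

End powers.

(** The exponent [r] of the limiting density is written [p + 2], as [r >= 2] is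
    assumed throughout. *)
Definition power_exp (R : realType) (c : R) (p : nat) (y : R) : R :=
  expR (- (c * y ^+ p.+2)).

(** In this section [I] stands for the tail integral of [power_exp c p], seen
    through its sign, the comparison of its increments with rectangles, and its
    decay. *)
Section laplace.
Variables (R : realType) (p : nat) (c : R) (I : R -> R) (KI : R).
Implicit Types a b e u z t v D E K X Y : R.
Hypothesis c0 : (0 : R) < c.
Local Notation q := (power_exp c p).
Hypothesis I_ge0 : forall z, 0 <= I z.
Hypothesis I_diff : forall a b, 0 <= a -> a <= b ->
  q b * (b - a) <= I a - I b /\ I a - I b <= q a * (b - a).
Hypothesis I_tail : forall Y, 0 <= Y -> I Y <= KI * expR (- (c / 2 * Y ^+ p.+2)).

Lemma power_exp_anti a b : 0 <= a -> a <= b -> q b <= q a.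
Proof.
move=> a0 ab; rewrite ler_expR lerN2 ler_pM2l //.
by apply: lerXn2r; rewrite ?nnegrE // (le_trans a0).
Qed.

Lemma power_exp_ge0 a : 0 <= q a. Proof. exact: expR_ge0. Qed.

Lemma tail_anti a b : 0 <= a -> a <= b -> I b <= I a.
Proof.
move=> a0 ab; have [h _] := I_diff a0 ab; rewrite -subr_ge0; apply: le_trans h.
by rewrite mulr_ge0 ?power_exp_ge0 // subr_ge0.
Qed.

(** On an interval of length [1 / (1 + z ^ (r-1))] above [z] the integrand stays
    comparable to its value at [z]; this is the true order of the tail. *)
Lemma tail_minorant : exists2 k : R, 0 < k &
  forall z, 0 <= z -> k * (q z / (1 + z ^+ p.+1)) <= I z.
Proof.
exists (expR (- (c * (p.+2%:R * 2 ^+ p.+1)))); first exact: expR_gt0.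
move=> z z0; have zp : 0 <= z ^+ p.+1 by apply: exprn_ge0.
set a := (1 + z ^+ p.+1)^-1.
have a0 : 0 < a by rewrite invr_gt0; lra.
have a1 : a <= 1 by rewrite invf_le1; lra.
have zza : z <= z + a by rewrite lerDl ltW.
have [h _] := I_diff z0 zza.
have h2 := I_ge0 (z + a).
apply: (@le_trans _ _ (q (z + a) * (z + a - z))); last lra.
rewrite addrAC subrr add0r mulrA ler_pM2r // /power_exp -expRD ler_expR.
rewrite -opprD lerN2 -mulrDr ler_pM2l //.
have := expr_lip p.+1 z0 zza; rewrite addrAC subrr add0r.
suff : p.+2%:R * a * (z + a) ^+ p.+1 <= p.+2%:R * 2 ^+ p.+1 by lra.
rewrite -mulrA ler_wpM2l // mulrC ler_pdivrMr; last lra.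
apply: le_trans (expr1D_le p.+1 z0); apply: lerXn2r; rewrite ?nnegrE; lra.
Qed.

(** The integrand decreases, so a Riemann sum differs from the integral by at
    most its first term. *)
Lemma riemann_sum_le D u N : 0 <= D -> 0 <= u ->
  I u - I (u + N%:R * D) <= \sum_(i < N) D * q (u + i%:R * D) /\
  \sum_(i < N) D * q (u + i%:R * D) <= D * q u + I u.
Proof.
move=> D0 u0; have ui i : 0 <= u + i%:R * D by rewrite addr_ge0 // mulr_ge0.
have step i : u + i%:R * D <= u + i.+1%:R * D by rewrite lerD2l ler_wpM2r // ler_nat.
have stepE i : u + i.+1%:R * D - (u + i%:R * D) = D by rewrite -natr1; ring.
split.
  elim: N => [|N IH]; first by rewrite big_ord0 mul0r addr0 subrr.
  rewrite big_ord_recr /=; have [_ h] := I_diff (ui N) (step N).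
  by rewrite stepE (mulrC (q _)) in h; lra.
case: N => [|N]; first by rewrite big_ord0 addr_ge0 // mulr_ge0 ?power_exp_ge0.
suff : \sum_(i < N.+1) D * q (u + i%:R * D) <= D * q u + (I u - I (u + N%:R * D)).
  by have := I_ge0 (u + N%:R * D); lra.
elim: N => [|N IH]; first by rewrite big_ord_recr big_ord0 /= mul0r !add0r addr0 subrr addr0.
rewrite big_ord_recr /=; have [h _] := I_diff (ui N) (step N).
by rewrite stepE (mulrC (q _)) in h; lra.
Qed.


(** The error factor is [expR E] with [E] of order [(1 + t^(r+1)) / X]. For
    [t <= e * X] and small [e] it eats at most half of the decay of the main
    term from [z] to [t], while at [t = z] it is bounded since
    [z ^ (r+1) <= X]. What remains decays exponentially in [t - z] at a rate
    proportional to [1 + z ^ (r-1)]. *)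
Lemma bulk_term_le K e : 0 < K -> 0 < e -> 4 * K * e <= c ->
  exists2 C : R, 0 < C & forall X z t D v : R, 1 <= X -> 0 <= z -> z ^+ p.+3 <= X ->
    z <= t -> t <= e * X -> 0 <= D ->
    (exists2 E : R, v = D * q t * expR E & `|E| <= K / X * (1 + t ^+ p.+3)) ->
    `|v - D * q t| <= C / X * (1 + z) ^+ p.+3 * q z *
      (D * expR (- (c / 2 * (1 + z ^+ p.+1) * (t - z)))).
Proof.
move=> K0 e0 Ke; have c20 : 0 < c / 2 by rewrite divr_gt0.
have [K3 K30 hK3] := poly_gauss_le p.+3 p c20.
exists (K * expR (2 * K) * K3); first by rewrite !mulr_gt0 ?expR_gt0.
move=> X z t D v X1 z0 zX zt teX D0 [E -> hE].
have X0 : 0 < X by lra.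
have t0 : 0 <= t := le_trans z0 zt.
have tz0 : 0 <= t - z by lra.
have -> : D * q t * expR E - D * q t = D * q t * (expR E - 1) by ring.
rewrite normrM [`|D * q t|]ger0_norm ?mulr_ge0 ?power_exp_ge0 //.
set E' := K / X * (1 + t ^+ p.+3) in hE.
have E'0 : 0 <= E' by rewrite (le_trans _ hE).
have hexp : `|expR E - 1| <= E' * expR E'.
  have /andP[h1 h2] : - E' <= E <= E' by rewrite -ler_norml.
  have h3 : expR E <= expR E' by rewrite ler_expR.
  have h4 := expR_ge1Dx E; have h5 := expR_ge1Dx (- E').
  have h6 : expR E' * expR (- E') = 1 by rewrite -expRD subrr expR0.
  have h7 := expR_gt0 E'.
  have h8 : expR E' - 1 <= E' * expR E'.
    have : expR E' * (1 - E') <= expR E' * expR (- E') by rewrite ler_pM2l.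
    by rewrite h6; lra.
  rewrite ler_norml; apply/andP; split; last lra.
  have h9 := expR_ge1Dx E'.
  have : E' * 1 <= E' * expR E' by apply: ler_wpM2l => //; lra.
  by lra.
apply: le_trans (ler_wpM2l _ hexp) _; first by rewrite mulr_ge0 ?power_exp_ge0.
have hpoly : 1 + t ^+ p.+3 <= (1 + z) ^+ p.+3 * (1 + (t - z)) ^+ p.+3.
  apply: le_trans (expr1D_ge _ t0) _.
  by apply: le_trans (expr1D_mul p.+3 z0 tz0); rewrite (addrC z) subrK.
have hgauss := hK3 _ tz0.
have hexpo : - (c * t ^+ p.+2) + E' <=
    2 * K - c * z ^+ p.+2 - c / 2 * z ^+ p.+1 * (t - z) - c / 2 * (t - z) ^+ p.+2.
  have h1 := expr_diff_le p z0 zt.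
  have h2 := expr_superadd p z0 tz0; rewrite (addrC z) subrK in h2.
  have h3 : E' <= K + K / X * z ^+ p.+3 + K / X * (t ^+ p.+3 - z ^+ p.+3).
    rewrite /E'; have : K / X <= K by rewrite ler_pdivrMr // ler_peMr // ltW.
    lra.
  have h4 : K / X * z ^+ p.+3 <= K.
    by rewrite mulrAC ler_pdivrMr // ler_pM2l.
  have hd : 0 <= t ^+ p.+2 - z ^+ p.+2.
    by rewrite subr_ge0; apply: lerXn2r; rewrite ?nnegrE.
  have h5 : K / X * (t ^+ p.+3 - z ^+ p.+3) <= c / 2 * (t ^+ p.+2 - z ^+ p.+2).
    apply: le_trans (ler_wpM2l _ h1) _; first by rewrite divr_ge0 ?ltW.
    rewrite mulrA ler_wpM2r //.
    have : K / X * (2 * t) <= K / X * (2 * (e * X)) by rewrite ler_pM2l ?divr_gt0 // ler_pM2l.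
    have -> : K / X * (2 * (e * X)) = 2 * K * e by field; rewrite gt_eqF.
    by lra.
  have h6 : c / 2 * (z ^+ p.+2 + (t - z) ^+ p.+2 + z ^+ p.+1 * (t - z)) <= c / 2 * t ^+ p.+2.
    by rewrite ler_pM2l //; lra.
  by lra.
have -> : D * q t * (E' * expR E') = D * E' * (q t * expR E') by ring.
have hq : q t * expR E' <= expR (2 * K) * q z * expR (- (c / 2 * z ^+ p.+1 * (t - z))) *
    expR (- (c / 2 * (t - z) ^+ p.+2)).
  by rewrite /power_exp -!expRD ler_expR; lra.
have DE0 : 0 <= D * E' by rewrite mulr_ge0.
apply: le_trans (ler_wpM2l DE0 hq) _.
have hE' : E' <= K / X * ((1 + z) ^+ p.+3 * (1 + (t - z)) ^+ p.+3).
  by rewrite /E' ler_pM2l // divr_gt0.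
set A := expR (2 * K); set B := expR (- (c / 2 * z ^+ p.+1 * (t - z))).
set G := expR (- (c / 2 * (t - z) ^+ p.+2)).
have nn : 0 <= A * q z * B * G by rewrite /power_exp /A /B /G; nneg.
apply: le_trans (ler_wpM2r nn (ler_wpM2l D0 hE')) _.
rewrite (_ : - (c / 2 * (1 + z ^+ p.+1) * (t - z)) =
  - (c / 2 * z ^+ p.+1 * (t - z)) - c / 2 * (t - z)); last by ring.
rewrite expRD -/B.
have nn2 : 0 <= D * (K / X) * (1 + z) ^+ p.+3 * A * q z * B.
  have K0' := ltW K0; have X0' := ltW X0; have z1 : 0 <= 1 + z by lra.
  rewrite /A /B /power_exp; nneg.
have := ler_wpM2l nn2 hgauss; rewrite -/G.
set T := (1 + (t - z)) ^+ p.+3; set Z := (1 + z) ^+ p.+3.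
by congr (_ <= _); field; rewrite gt_eqF.
Qed.

(** The Laplace comparison. The scale is [X = n ^ (1/r)] with [r = p + 2], and the
    lattice spacing is [D = 2 / X ^ (r-1)]. Summing [bulk_term_le] as a geometric
    series gives a factor of order [1 / (1 + z ^ (r-1))], which [tail_minorant]
    recognizes as the size of the tail; the error of the Riemann sum, at most
    [D * power_exp c p z], and the terms beyond [e * X], which are exponentially
    small in [X ^ 2], are of lower order. Hence the error is relative to the tail
    itself, uniformly in [z ^ (r+1) <= X]. *)
Lemma lattice_tail (K e eta Kf : R) : 0 < K -> 0 < e -> 4 * K * e <= c ->
  0 < eta -> eta <= c / 2 * e ^+ p.+2 -> 0 < Kf -> 0 < KI ->
  exists2 C : R, 0 < C & forall (X z u D : R) (N : nat) (v : nat -> R),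
    1 <= X -> 0 <= z -> z ^+ p.+3 <= X ->
    0 <= D -> D * X ^+ p.+1 = 2 ->
    z <= u -> u <= z + D -> e * X <= u + N%:R * D -> N%:R <= 2 * X ^+ p.+2 ->
    (forall i, (i < N)%N -> u + i%:R * D <= e * X ->
       exists2 E : R, v i = D * q (u + i%:R * D) * expR E &
         `|E| <= K / X * (1 + (u + i%:R * D) ^+ p.+3)) ->
    (forall i, (i < N)%N -> e * X < u + i%:R * D -> `|v i| <= D * (Kf * expR (- (eta * X ^+ 2)))) ->
    `|\sum_(i < N) v i - I z| <= C / X * (1 + z) ^+ p.+3 * I z.
Proof.
move=> K0 e0 Ke eta0 etae Kf0 KI0.
have [C1 C10 hC1] := bulk_term_le K0 e0 Ke.
have [k k0 hk] := tail_minorant.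
pose C2 := C1 * (4 + 2 / c).
pose C3 := 2 * expR (c + (c + p.+3%:R) ^+ 2 / (4 * eta)).
pose C4 := 4 + C2 + (4 * (Kf + 1) + KI) * C3.
have C30 : 0 < C3 by rewrite mulr_gt0 ?expR_gt0.
have C20 : 0 < C2 by rewrite mulr_gt0 // addr_gt0 ?divr_gt0.
have C40 : 0 < C4.
  by rewrite !addr_gt0 // mulr_gt0 // !addr_gt0 // mulr_gt0 // addr_gt0.
exists (C4 / k); first by rewrite divr_gt0.
move=> X z u D N v X1 z0 zX D0 DX zu uz eXu NX hbulk hfar.
have X0 : 0 < X by lra.
have u0 := le_trans z0 zu.
set W := 1 + z ^+ p.+1.
have W1 : 1 <= W by rewrite lerDl exprn_ge0.
have W0 : 0 < W by lra.
set Z := (1 + z) ^+ p.+3.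
have Z1 : 1 <= Z by rewrite exprn_ege1 // lerDl.
have Z0 : 0 < Z by lra.
set B := q z / W.
have B0 : 0 < B by rewrite divr_gt0 // expR_gt0.
have hB : k * B <= I z by apply: hk.
have ui0 i : 0 <= u + i%:R * D by rewrite addr_ge0 // mulr_ge0.
have z_le_X : z <= X.
  have [z1|z1] := leP z 1; first lra.
  apply: le_trans zX; rewrite -[leLHS]mulr1 exprS ler_pM2l; last lra.
  by rewrite exprn_ege1 // ltW.
have XpW : W <= 2 * X ^+ p.+1.
  have : z ^+ p.+1 <= X ^+ p.+1 by apply: lerXn2r; rewrite ?nnegrE // ltW.
  have : 1 <= X ^+ p.+1 by rewrite exprn_ege1.
  by rewrite /W; lra.
have DW : D * W <= 4.
  by apply: le_trans (ler_wpM2l D0 XpW) _; rewrite mulrCA DX; lra.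
have hWZ : W <= Z.
  apply: le_trans (expr1D_ge _ z0) _.
  by apply: ler_weXn2l; [rewrite lerDl | exact: leqW (leqnSn _)].
(* As [c * z ^ r <= c * (1 + X)], [B] is at worst exponentially small in [X],
   while the left-hand side is Gaussian in [X]. *)
have hsmall : X * expR (- (eta * X ^+ 2)) <= C3 / X * B.
  have hW2 : 1 / (2 * X ^+ p.+1) * expR (- (c * (1 + X))) <= B.
    rewrite /B [leRHS]mulrC; apply: ler_pM => //; rewrite ?divr_ge0 ?mulr_ge0 ?exprn_ge0 ?expR_ge0 //; try lra.
      by rewrite mul1r lef_pV2 ?posrE // mulr_gt0 ?exprn_gt0.
    rewrite /power_exp ler_expR lerN2 ler_pM2l //.
    have [z1|z1] := leP z 1.
      have : z ^+ p.+2 <= 1 by apply: exprn_ile1.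
      by lra.
    have : z ^+ p.+2 <= z ^+ p.+3 by apply: ler_weXn2l => //; exact: ltW.
    by lra.
  apply: le_trans (ler_wpM2l _ hW2); last by rewrite divr_ge0 ?ltW.
  rewrite /C3; set G := expR (c + _).
  have -> : 2 * G / X * (1 / (2 * X ^+ p.+1) * expR (- (c * (1 + X)))) =
    G * expR (- (c * (1 + X))) / X ^+ p.+2.
    by rewrite [X ^+ p.+2]exprS; field; rewrite !gt_eqF ?exprn_gt0.
  rewrite ler_pdivlMr ?exprn_gt0 // mulrAC -exprS.
  have := expr_le_expR p.+3 (ltW X0) => hX.
  apply: le_trans (ler_wpM2r (expR_ge0 _) hX) _.
  rewrite /G -!expRD ler_expR.
  have := quad_le (c + p.+3%:R) X eta0; lra.
have hfarq i : e * X < u + i%:R * D -> q (u + i%:R * D) <= expR (- (eta * X ^+ 2)).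
  move=> h; have eX0 : 0 <= e * X by rewrite mulr_ge0 ?ltW.
  apply: le_trans (power_exp_anti eX0 (ltW h)) _.
  rewrite /power_exp ler_expR lerN2 exprMn.
  have hX2 : X ^+ 2 <= X ^+ p.+2 by apply: ler_weXn2l.
  have hX0 : 0 <= X ^+ 2 by rewrite exprn_ge0 // ltW.
  have he : 0 < e ^+ p.+2 by rewrite exprn_gt0.
  have h1 : eta * X ^+ 2 <= c / 2 * e ^+ p.+2 * X ^+ 2 by rewrite ler_wpM2r.
  have h2 : c / 2 * e ^+ p.+2 * X ^+ 2 <= c / 2 * e ^+ p.+2 * X ^+ p.+2.
    by rewrite ler_wpM2l //; nneg.
  have h3 : 0 <= c / 2 * e ^+ p.+2 * X ^+ p.+2.
    by nneg.
  by rewrite mulrA; lra.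
have hsum : `|\sum_(i < N) v i - \sum_(i < N) D * q (u + i%:R * D)| <=
    C2 / X * Z * B + 4 * (Kf + 1) * (X * expR (- (eta * X ^+ 2))).
  rewrite -sumrB.
  apply: (@le_trans _ _ (\sum_(i < N) (C1 / X * Z * q z *
      (D * expR (- (c / 2 * W * D * i%:R))) + D * ((Kf + 1) * expR (- (eta * X ^+ 2)))))).
    apply: le_trans (ler_norm_sum _ _ _) _; apply: ler_sum => i _.
    have nn1 : 0 <= C1 / X * Z * q z * (D * expR (- (c / 2 * W * D * i%:R))).
      by rewrite /power_exp; nneg.
    have [hle|hgt] := leP (u + i%:R * D) (e * X).
    - have zt : z <= u + i%:R * D by rewrite (le_trans zu) // lerDl mulr_ge0.
      have := hC1 X z _ D _ X1 z0 zX zt hle D0 (hbulk i (ltn_ord i) hle).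
      move=> /le_trans; apply; apply: ler_wpDr.
        by nneg.
      rewrite ler_wpM2l //; first by rewrite /power_exp; nneg.
      rewrite ler_wpM2l // ler_expR lerN2 -[c / 2 * W * D * _]mulrA ler_wpM2l //.
        by nneg.
      by rewrite mulrC; lra.
    - apply: ler_wpDl => //.
      apply: le_trans (ler_normB _ _) _.
      have h1 := hfar i (ltn_ord i) hgt.
      have h2 : `|D * q (u + i%:R * D)| <= D * expR (- (eta * X ^+ 2)).
        by rewrite ger0_norm ?mulr_ge0 ?power_exp_ge0 // ler_wpM2l // hfarq.
      by rewrite mulrDl mul1r mulrDr; apply: lerD.
  rewrite big_split /= -mulr_sumr sumr_const card_ord -mulr_sumr; apply: lerD.
  - rewrite (_ : C2 / X * Z * B = C1 / X * Z * q z * ((4 + 2 / c) / W)); last first.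
      by rewrite /C2 /B; field; rewrite !gt_eqF.
    rewrite ler_wpM2l //; first by rewrite /power_exp; nneg.
    have D1 : 0 < D.
      by rewrite lt_neqAle D0 andbT eq_sym; apply/eqP => D0'; move: DX; rewrite D0' mul0r; lra.
    have a0 : 0 < c / 2 * W * D by rewrite !mulr_gt0 // invr_gt0.
    apply: le_trans (ler_wpM2l D0 (geometric_expR_le N a0)) _.
    rewrite ler_pdivlMr //.
    have -> : D * (1 + (c / 2 * W * D)^-1) * W = D * W + 2 / c by field; rewrite !gt_eqF.
    by lra.
  - rewrite -[leLHS]mulr_natl.
    have -> : N%:R * (D * ((Kf + 1) * expR (- (eta * X ^+ 2)))) =
      (Kf + 1) * expR (- (eta * X ^+ 2)) * (D * N%:R) by ring.
    have -> : 4 * (Kf + 1) * (X * expR (- (eta * X ^+ 2))) =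
      (Kf + 1) * expR (- (eta * X ^+ 2)) * (4 * X) by ring.
    rewrite ler_wpM2l ?mulr_ge0 ?expR_ge0 ?addr_ge0 // ?(ltW Kf0) //.
    apply: le_trans (ler_wpM2l D0 NX) _.
    by rewrite mulrCA exprS (mulrCA D) DX; lra.
have [hlow hup] := riemann_sum_le N D0 u0.
have hIu : I u <= I z by apply: tail_anti.
have hIz : I z - I u <= D * q z.
  have [_ h] := I_diff z0 zu; apply: le_trans h _.
  by rewrite mulrC ler_wpM2r ?power_exp_ge0 //; lra.
have hqu : D * q u <= D * q z by rewrite ler_wpM2l // power_exp_anti.
have hIend : I (u + N%:R * D) <= KI * expR (- (eta * X ^+ 2)).
  have eX0 : 0 <= e * X by rewrite mulr_ge0 ?ltW.
  apply: le_trans (tail_anti eX0 eXu) _; apply: le_trans (I_tail eX0) _.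
  rewrite ler_wpM2l ?(ltW KI0) // ler_expR lerN2 exprMn (mulrA (c / 2)).
  apply: ler_pM; rewrite ?(ltW eta0) ?exprn_ge0 ?(ltW X0) //.
  by apply: ler_weXn2l.
have hDq : D * q z <= 4 / X * Z * B.
  (* [D <= 2 / X] because [r >= 2]. *)
  have DX2 : D <= 2 / X.
    rewrite ler_pdivlMr // -DX ler_wpM2l // -[leLHS]mulr1 exprS ler_wpM2l ?(ltW X0) //.
    by rewrite exprn_ege1.
  have -> : q z = W * B by rewrite /B mulrCA mulfV ?mulr1 // gt_eqF.
  rewrite mulrA; apply: ler_wpM2r; first exact: ltW.
  apply: ler_pM => //; first exact: ltW.
  by apply: le_trans DX2 _; rewrite ler_wpM2r ?invr_ge0 ?ltW // ; lra.
have hsm1 : expR (- (eta * X ^+ 2)) <= C3 / X * B.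
  by apply: le_trans hsmall; rewrite ler_peMl ?expR_ge0.
have hZB : C3 / X * B <= C3 / X * Z * B.
  have -> : C3 / X * Z * B = C3 / X * B * Z by ring.
  by apply: ler_peMr => //; nneg.
have hfin : `|\sum_(i < N) v i - I z| <= C4 / X * Z * B.
  have tri : `|\sum_(i < N) v i - I z| <=
    `|\sum_(i < N) v i - \sum_(i < N) D * q (u + i%:R * D)| +
    `|\sum_(i < N) D * q (u + i%:R * D) - I z| by apply: ler_distD.
  apply: le_trans tri _.
  have h2 : `|\sum_(i < N) D * q (u + i%:R * D) - I z| <=
     4 / X * Z * B + KI * (C3 / X * Z * B).
    have hk2 : KI * expR (- (eta * X ^+ 2)) <= KI * (C3 / X * Z * B).
      by rewrite ler_pM2l //; lra.
    have nn : 0 <= KI * (C3 / X * Z * B).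
      by nneg.
    rewrite ler_norml; apply/andP; split; lra.
  have h3 : 4 * (Kf + 1) * (X * expR (- (eta * X ^+ 2))) <= 4 * (Kf + 1) * (C3 / X * Z * B).
    by apply: ler_wpM2l; [rewrite mulr_ge0 // addr_ge0 // ltW | lra].
  rewrite /C4; lra.
apply: le_trans hfin _.
have -> : C4 / X * Z * B = C4 / k / X * Z * (k * B) by field; rewrite !gt_eqF.
by apply: ler_wpM2l => //; nneg.
Qed.

End laplace.

(** * Tails of the limiting laws *)

Definition power_tail (R : realType) (c : R) (p : nat) (z : R) : R :=
  Rintegral (@lebesgue_measure R) `]z, +oo[ (power_exp c p).

(** For even [r >= 2], [x ^ r >= x ^ 2 - 1], so a Gaussian dominates. *)
Lemma integrable_power_exp (R : realType) (c : R) (p : nat) (A : set R) :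
  0 < c -> ~~ odd p -> measurable A ->
  (@lebesgue_measure R).-integrable A (EFin \o power_exp c p).
Proof.
move=> c0 ep mA; apply: (@integrableS _ _ _ _ setT) => //.
pose s := Num.sqrt ((2 * c)^-1).
have i2c : 0 < (2 * c)^-1 by rewrite invr_gt0; lra.
have s0 : s != 0 by rewrite gt_eqF // sqrtr_gt0.
have pk : normal_peak s != 0 by rewrite gt_eqF // normal_peak_gt0.
have mq : measurable_fun [set: R] (power_exp c p).
  rewrite /power_exp; apply: measurableT_comp => //=; apply: measurableT_comp => //=.
  by apply: measurable_funM => //=; exact: measurable_funX.
have := @le_integrable _ _ R (@lebesgue_measure R) setT measurableT
  (EFin \o power_exp c p)
  (fun x => (expR c / normal_peak s)%:E * (normal_pdf 0 s x)%:E)%E; apply.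
- exact/measurable_EFinP.
- move=> x _; rewrite /= lee_fin !ger0_norm ?expR_ge0 //; last first.
    by rewrite mulr_ge0 ?normal_pdf_ge0 // divr_ge0 ?expR_ge0 // normal_peak_ge0.
  rewrite normal_pdfE //= [leRHS]mulrA divfK // /normal_fun subr0 -expRD ler_expR.
  rewrite sqr_sqrtr; last exact: ltW.
  have -> : - x ^+ 2 / ((2 * c)^-1 *+ 2) = - (c * x ^+ 2).
    by rewrite -mulr_natr; field; rewrite gt_eqF.
  have -> : c - c * x ^+ 2 = - (c * (x ^+ 2 - 1)) by ring.
  rewrite lerN2 ler_pM2l //.
  have -> : x ^+ p.+2 = x ^+ 2 * (x ^+ 2) ^+ p./2.
    by rewrite -exprM -exprD; congr (_ ^+ _); move: ep; lia.
  have x2 : 0 <= x ^+ 2 by apply: sqr_ge0.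
  have [l1|g1] := leP (x ^+ 2) 1.
    by have := mulr_ge0 x2 (exprn_ge0 p./2 x2); lra.
  have : x ^+ 2 * 1 <= x ^+ 2 * (x ^+ 2) ^+ p./2.
    by rewrite ler_wpM2l // exprn_ege1 // ltW.
  by lra.
- by apply: integrableZl => //; exact: integrable_normal_pdf.
Qed.

Section power_tail.
Variables (R : realType) (c : R) (p : nat).
Hypotheses (c0 : (0 : R) < c) (ep : ~~ odd p).
Local Notation q := (power_exp c p).
Local Notation mu := (@lebesgue_measure R).

Let q_int A : measurable A -> mu.-integrable A (EFin \o q).
Proof. exact: integrable_power_exp. Qed.

Lemma power_tail_ge0 z : 0 <= power_tail c p z.
Proof. by apply: Rintegral_ge0 => x _; exact: expR_ge0. Qed.

Lemma power_tail_diff (a b : R) : 0 <= a -> a <= b ->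
  q b * (b - a) <= power_tail c p a - power_tail c p b /\
  power_tail c p a - power_tail c p b <= q a * (b - a).
Proof.
move=> a0 ab.
have E : power_tail c p a - power_tail c p b = \int[mu]_(x in `]a, b]) q x.
  rewrite /power_tail -(@Rintegral_itvB _ _ (BRight a) +oo%O b) ?bnd_simp //; last exact: q_int.
  by rewrite opprB addrCA subrr addr0.
have cst (r : R) : mu.-integrable `]a, b] (EFin \o (fun=> r)).
  have := @integrableS _ _ R mu `[a, b]%classic `]a, b]%classic (EFin \o (fun=> r)); apply => //.
    by apply: subset_itvr; rewrite bnd_simp.
  apply: continuous_compact_integrable; first exact: segment_compact.
  by apply: continuous_subspaceT => x; exact: cst_continuous.
have vol (r : R) : \int[mu]_(x in `]a, b]) r = r * (b - a).
  rewrite Rintegral_cst //= lebesgue_measure_itv /= lte_fin; case: ltP => //= ba.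
  by rewrite (_ : b = a) ?subrr //; apply/eqP; rewrite eq_le ba ab.
rewrite E -!vol; split; apply: le_Rintegral => //; try exact: q_int.
- move=> x /=; rewrite in_itv /= => /andP[ax xb]; apply: power_exp_anti => //.
  exact: le_trans a0 (ltW ax).
- by move=> x /=; rewrite in_itv /= => /andP[ax xb]; apply: power_exp_anti => //; exact: ltW.
Qed.

Let cont_q : continuous q.
Proof.
rewrite /power_exp => x; apply: continuous_comp; last exact: continuous_expR.
apply: continuousN; apply: continuousM; first exact: cst_continuous.
exact: exprn_continuous.
Qed.

Let cq_meas : measurable_fun setT q.
Proof. exact: continuous_measurable_fun. Qed.

Lemma power_total : \int[mu]_x q x = 2 * power_tail c p 0.
Proof.
rewrite /Rintegral ge0_symfun_integralT.
- rewrite (_ : [set x | _] = `[0, +oo[%classic); last first.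
    by apply/seteqP; split => x/=; rewrite in_itv/= andbT.
  rewrite -integral_itv_obnd_cbnd; last by apply/measurable_EFinP/measurable_funTS; exact: cq_meas.
  rewrite -[in RHS](_ : fine 2%:E = 2) // -fineM //.
  apply: integrable_fin_num => //; exact: q_int.
- by move=> x; exact: expR_ge0.
- exact: cont_q.
- by move=> x /=; rewrite /power_exp exprNn -signr_odd /= negbK (negbTE ep) mul1r.
Qed.

End power_tail.

(** Half of the exponent is frozen at its value at [Y], the other half is
    integrated. *)
Lemma power_tail_bound (R : realType) (c : R) (p : nat) : 0 < c -> ~~ odd p ->
  exists2 K : R, 0 < K & forall Y, 0 <= Y ->
    power_tail c p Y <= K * expR (- (c / 2 * Y ^+ p.+2)).
Proof.
move=> c0 ep; have c2 : 0 < c / 2 by rewrite divr_gt0.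
have K0 := @power_tail_ge0 R (c / 2) p 0.
exists (power_tail (c / 2) p 0 + 1); first lra.
move=> Y Y0.
have mY : measurable `]Y, +oo[ by [].
apply: (@le_trans _ _ (power_tail (c / 2) p Y * expR (- (c / 2 * Y ^+ p.+2)))).
  rewrite /power_tail -RintegralZr //; last exact: integrable_power_exp.
  apply: le_Rintegral => //; first exact: integrable_power_exp.
    rewrite (_ : EFin \o _ = (fun x => (expR (- (c / 2 * Y ^+ p.+2)))%:E *
      (EFin \o power_exp (c / 2) p) x)%E); last first.
      by apply/funext => x /=; rewrite -EFinM mulrC.
    by apply: integrableZl => //; exact: integrable_power_exp.
  move=> x /=; rewrite in_itv /= andbT => Yx.
  rewrite /power_exp -expRD ler_expR.
  have : Y ^+ p.+2 <= x ^+ p.+2.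
    by apply: lerXn2r; rewrite ?nnegrE // ?(le_trans Y0) ?ltW.
  have -> : - (c * x ^+ p.+2) = - (c / 2 * x ^+ p.+2) - c / 2 * x ^+ p.+2 by field.
  by rewrite lerD2l lerN2 ler_pM2l.
rewrite ler_wpM2r ?expR_ge0 //.
have [h _] := power_tail_diff c2 ep (lexx 0) Y0.
have : 0 <= power_exp (c / 2) p Y * (Y - 0) by rewrite mulr_ge0 ?expR_ge0 ?subr0.
by lra.
Qed.

(** Both limiting laws are symmetric, so their normalizing constant is twice the
    tail integral at [0]. *)
Lemma normal_tailE (R : realType) (v z : R) : 0 < v ->
  normal_tail v z = power_tail (2 * v)^-1 0 z / (2 * power_tail (2 * v)^-1 0 0).
Proof.
move=> v0; have c0 : 0 < (2 * v)^-1 by rewrite invr_gt0; lra.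
have s0 : Num.sqrt v != 0 by rewrite gt_eqF // sqrtr_gt0.
have pdfE : normal_pdf 0 (Num.sqrt v) =
    (fun x => normal_peak (Num.sqrt v) * power_exp (2 * v)^-1 0 x).
  rewrite normal_pdfE //; apply/funext => x; rewrite /normal_fun subr0 sqr_sqrtr; last exact: ltW.
  by rewrite /power_exp; congr (_ * expR _); rewrite -mulr_natr; field; rewrite gt_eqF.
have pE A : measurable A -> fine (normal_prob 0 (Num.sqrt v) A) =
    normal_peak (Num.sqrt v) *
    \int[@lebesgue_measure R]_(x in A) power_exp (2 * v)^-1 0 x.
  move=> mA; rewrite -RintegralZl //; last exact: (integrable_power_exp (p := 0)).
  by rewrite /normal_prob pdfE.
have tot : normal_peak (Num.sqrt v) * (2 * power_tail (2 * v)^-1 0 0) = 1.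
  by rewrite -power_total // -pE // probability_setT.
rewrite /normal_tail pE // -/(power_tail (2 * v)^-1 0 z).
have nz : 2 * power_tail (2 * v)^-1 0 0 != 0.
  by apply/eqP => E0; move: tot; rewrite E0 mulr0 => /esym/eqP; rewrite oner_eq0.
by apply: (mulIf nz); rewrite divfK // mulrAC tot mul1r.
Qed.

Lemma quartic_tailE (R : realType) (l z : R) : 0 < l ->
  quartic_tail l z = power_tail (l / 24) 2 z / (2 * power_tail (l / 24) 2 0).
Proof.
move=> l0; have c0 : 0 < l / 24 by rewrite divr_gt0.
have E : quartic_fun l = power_exp (l / 24) 2.
  by apply/funext => y; rewrite /quartic_fun /power_exp mulrAC.
rewrite /quartic_tail /quartic_pdf E power_total // RintegralZl //; last exact: integrable_power_exp.
by rewrite mulrC.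
Qed.

(** * The free energy and its Legendre duality with H *)

(** The logarithm of [k! / (k/e)^k]. Constant factors of the weights cancel in the
    probabilities, so that only differences of this function matter; they are
    controlled by its small increments. *)
Definition stirling_gap (R : realType) (k : nat) : R :=
  ln k`!%:R - k%:R * ln k%:R + k%:R.

(** The increment is [1 - k (ln (k+1) - ln k)]. *)
Lemma stirling_gap_step (R : realType) (k : nat) :
  0 <= stirling_gap R k.+1 - stirling_gap R k <= k.+1%:R^-1.
Proof.
rewrite /stirling_gap; case: k => [|k].
  by rewrite mul0r fact0 factS muln1 !ln1 mulr0 invr1; apply/andP; split; lra.
have k0 : (0 : R) < k.+1%:R by rewrite ltr0n.
have k1 : (0 : R) < k.+2%:R by rewrite ltr0n.
have f0 : (0 : R) < (k.+1)`!%:R by rewrite ltr0n fact_gt0.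
rewrite factS natrM lnM ?posrE //.
set a : R := k.+1%:R in k0 *.
have aE : k.+2%:R = a + 1 by rewrite /a natr1.
rewrite aE in k1 *; clear aE; clearbody a.
have h1 : ln (a + 1) - ln a <= a^-1.
  rewrite -ln_div ?posrE // (_ : (a + 1) / a = 1 + a^-1); last by field; rewrite gt_eqF.
  have a1 : 0 < a^-1 by rewrite invr_gt0.
  by apply: le_ln1Dx; lra.
have h2 : (a + 1)^-1 <= ln (a + 1) - ln a.
  rewrite -opprB lerNr -ln_div ?posrE //.
  rewrite (_ : a / (a + 1) = 1 + - (a + 1)^-1); last by field; rewrite gt_eqF.
  by apply: le_ln1Dx; rewrite ltrN2 invf_lt1 //; lra.
have h3 : a * (ln (a + 1) - ln a) <= 1.
  by apply: le_trans (ler_wpM2l (ltW k0) h1) _; rewrite mulfV ?gt_eqF.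
have h4 : 1 - (a + 1)^-1 <= a * (ln (a + 1) - ln a).
  apply: le_trans (ler_wpM2l (ltW k0) h2).
  by rewrite (_ : a / (a + 1) = 1 - (a + 1)^-1) //; field; rewrite gt_eqF.
by apply/andP; split; lra.
Qed.

Lemma stirling_gap_lip (R : realType) (l k : nat) : (l <= k)%N ->
  0 <= stirling_gap R k - stirling_gap R l <= (k%:R - l%:R) / l.+1%:R.
Proof.
move=> lk; rewrite -(subnK lk); elim: (k - l)%N => [|j /andP[IH1 IH2]].
  by rewrite add0n !subrr mul0r lexx.
have /andP[h1 h2] := stirling_gap_step R (j + l).
rewrite addSn; apply/andP; split; first lra.
have h3 : ((j + l).+1%:R^-1 : R) <= l.+1%:R^-1.
  by rewrite lef_pV2 ?posrE ?ltr0n // ler_nat ltnS leq_addl.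
rewrite -(natr1 (j + l)).
have -> : ((j + l)%:R + 1 - l%:R) / l.+1%:R = ((j + l)%:R - l%:R) / l.+1%:R + l.+1%:R^-1 :> R by ring.
apply: le_trans (lerD IH2 (le_trans h2 h3)).
by rewrite le_eqVlt; apply/orP; left; apply/eqP; ring.
Qed.

Lemma stirling_gap0 (R : realType) : stirling_gap R 0 = 0.
Proof. by rewrite /stirling_gap fact0 ln1 mul0r subr0 addr0. Qed.

Lemma stirling_gap_ge0 (R : realType) (k : nat) : 0 <= stirling_gap R k.
Proof. by have /andP[] := stirling_gap_lip R (leq0n k); rewrite stirling_gap0 subr0. Qed.

Lemma stirling_gap_le (R : realType) (n k : nat) : (k <= n)%N -> (0 < n)%N ->
  stirling_gap R k <= 1 + ln n%:R.
Proof.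
move=> kn n0; apply: (@le_trans _ _ (stirling_gap R n)).
  by have /andP[h _] := stirling_gap_lip R kn; lra.
case: n n0 {kn} => // n _; elim: n => [|n IH].
  by rewrite /stirling_gap factS fact0 muln1 !ln1 mulr0; lra.
have /andP[_ h] := stirling_gap_step R n.+1.
have n0 : (0 : R) < n.+1%:R by rewrite ltr0n.
have n1 : (0 : R) < n.+2%:R by rewrite ltr0n.
suff : (n.+2%:R^-1 : R) <= ln n.+2%:R - ln n.+1%:R
  by move/(le_trans h); lra.
rewrite -opprB lerNr -ln_div ?posrE //.
rewrite (_ : n.+1%:R / n.+2%:R = 1 + - (n.+2%:R)^-1); last first.
  rewrite -natr1 in n1 *; move: n0 n1; move: (n.+1%:R : R) => a _ a1.
  by field; rewrite gt_eqF.
by apply: le_ln1Dx; rewrite ltrN2 invf_lt1 // ltr1n.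
Qed.

(** The exponential rate of the weight of a monomer density [x]: the coupling and
    the field minus a convex entropy whose derivative is [ln x - ln (1 - x) / 2]. At the
    end points [0] and [1] the convention [ln 0 = 0] gives the right values. *)
Definition free_energy (R : realType) (J h x : R) : R :=
  J * x ^+ 2 + (h - J) * x
  - (x * ln x - x + (1 - x) / 2 * ln (1 - x) - (1 - x) / 2).

(** Exact: the powers of [n] coming from the factorials cancel against the term
    [ln n / 2] of the field, up to a factor that does not depend on [k]. *)
Lemma monomer_dimer_weightE (R : realType) (J h : R) (n k d : nat) :
  (0 < n)%N -> (k + d.*2 = n)%N ->
  monomer_dimer_weight J h n k d =
  expR (ln n`!%:R - n%:R / 2 * ln n%:R + n%:R * free_energy J h (k%:R / n%:R)
        - stirling_gap R k - stirling_gap R d).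
Proof.
move=> n0 kdn.
have F m : (0 : R) < m`!%:R by rewrite ltr0n fact_gt0.
have nR : (0 : R) < n%:R by rewrite ltr0n.
have nE : n%:R = k%:R + 2 * d%:R :> R by rewrite -kdn natrD -muln2 natrM mulrC.
have two : (0 : R) < 2 ^+ d by rewrite exprn_gt0.
have xlnx m : m%:R * ln (m%:R / n%:R) = m%:R * (ln m%:R - ln n%:R) :> R.
  case: m => [|m]; first by rewrite !mul0r.
  by rewrite ln_div ?posrE ?ltr0n.
have xlnx2 : d%:R * ln (1 - k%:R / n%:R) = d%:R * (ln 2 + ln d%:R - ln n%:R) :> R.
  have -> : 1 - k%:R / n%:R = 2 * d%:R / n%:R :> R.
    by rewrite [in RHS](_ : 2 * d%:R = n%:R - k%:R) ?mulrBl ?divff ?gt_eqF // nE; ring.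
  case: d {kdn F nE two} => [|m]; first by rewrite !mul0r.
  by rewrite ln_div ?posrE ?lnM ?posrE ?mulr_gt0 ?ltr0n.
pose W : R := n`!%:R / (k`!%:R * (2 ^+ d * d`!%:R)).
have W0 : 0 < W by rewrite /W divr_gt0 // !mulr_gt0.
have lnW : ln W = ln n`!%:R - ln k`!%:R - d%:R * ln 2 - ln d`!%:R.
  rewrite /W ln_div ?posrE ?mulr_gt0 // lnM ?posrE ?mulr_gt0 // lnM ?posrE //.
  by rewrite lnXn // -mulr_natl; ring.
rewrite /monomer_dimer_weight -/W -{1}(lnK (x := W)) ?posrE // -expRD lnW; congr expR.
rewrite /free_energy /stirling_gap /field_b.
set x := k%:R / n%:R.
have nx : n%:R * x = k%:R by rewrite /x mulrCA divff ?mulr1 // gt_eqF.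
have n1x : n%:R * (1 - x) = 2 * d%:R by rewrite mulrBr nx mulr1 nE; ring.
have e1 : n%:R * (x * ln x) = k%:R * (ln k%:R - ln n%:R) by rewrite mulrA nx xlnx.
have e2 : n%:R * ((1 - x) / 2 * ln (1 - x)) = d%:R * (ln 2 + ln d%:R - ln n%:R).
  by rewrite !mulrA n1x -xlnx2 -/x; field.
have e3 : n%:R * ((1 - x) / 2) = d%:R by rewrite mulrA n1x; field.
have e4 : n%:R * ((ln n%:R / 2 + h - J) * x) = (ln n%:R / 2 + h - J) * k%:R by rewrite mulrCA nx.
have e5 : n%:R * ((h - J) * x) = (h - J) * k%:R by rewrite mulrCA nx.
have e6 : n%:R / 2 * ln n%:R = (k%:R / 2 + d%:R) * ln n%:R :> R.
  by rewrite [X in X / 2]nE; field.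
lra.
Qed.

Section legendre.
Variable R : realType.
Implicit Types t x y J h : R.

Lemma g_spec t : [/\ 0 < g t, g t < 1 & g t ^+ 2 = expR (2 * t) * (1 - g t)].
Proof.
rewrite /g; set E := expR (2 * t); have E0 : 0 < E by apply: expR_gt0.
have -> : expR (4 * t) = E ^+ 2 by rewrite /E -expRM_natl; congr expR; ring.
set S := Num.sqrt _.
have S2 : S ^+ 2 = E ^+ 2 + 4 * E by rewrite sqr_sqrtr //; have := sqr_ge0 E; lra.
have S0 : 0 <= S by apply: sqrtr_ge0.
have E0' : 0 <= E := ltW E0.
have E2 : 0 <= E + 2 by lra.
have SE : E < S by rewrite -ltr_sqr ?nnegrE // S2; lra.
have SE2 : S < E + 2 by rewrite -ltr_sqr ?nnegrE // S2; lra.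
split; [lra | lra |].
have -> : ((S - E) / 2) ^+ 2 = (S ^+ 2 - 2 * S * E + E ^+ 2) / 4 by field.
by rewrite S2; field.
Qed.

(** [g] is the inverse of the derivative of the entropy. *)
Lemma ln_g t : ln (g t) - ln (1 - g t) / 2 = t.
Proof.
have [g0 g1 gE] := g_spec t.
have := congr1 (@ln R) gE; rewrite lnXn // lnM ?posrE ?expR_gt0 ?subr_gt0 // expRK.
by rewrite mulr2n; lra.
Qed.

Lemma mul_ln_le x y : 0 <= x -> 0 < y -> x * ln y - x * ln x <= y - x.
Proof.
rewrite le_eqVlt => /predU1P[<-|x0] y0; first by rewrite !mul0r; lra.
rewrite -mulrBr -ln_div ?posrE //.
have yx : 0 < y / x by rewrite divr_gt0.
have : -1 < y / x - 1 by lra.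
move=> /le_ln1Dx; rewrite addrC subrK => /(ler_wpM2l (ltW x0)) /le_trans; apply.
by rewrite mulrBr mulr1 mulrCA divff ?mulr1 // gt_eqF.
Qed.

(** Fenchel's inequality for the entropy, whose conjugate is the second term of
    [H] up to the constant [1]; [tau] is affine, and completing the square turns
    [tau y * x - J y^2] into [J x^2 + (h - J) x - J (x - y)^2]. *)
Lemma free_energy_le_H J h x y : 0 <= x -> x <= 1 ->
  free_energy J h x - J * (x - y) ^+ 2 <= H J h y + 1.
Proof.
move=> x0 x1; have [g0 g1 _] := g_spec (tau J h y).
have t := ln_g (tau J h y); rewrite /H.
set G := g _ in g0 g1 t *.
have h1 := mul_ln_le x0 g0.
have h2 : (1 - x) * ln (1 - G) - (1 - x) * ln (1 - x) <= (1 - G) - (1 - x).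
  by apply: mul_ln_le; lra.
have h3 : (ln G - ln (1 - G) / 2) * x = tau J h y * x by rewrite t.
rewrite /free_energy; rewrite /tau in h3; lra.
Qed.

(** The equality case of Fenchel's inequality. *)
Lemma H_free_energy J h y : let x := g (tau J h y) in
  H J h y + 1 = free_energy J h x - J * (x - y) ^+ 2.
Proof.
move=> x; have [g0 g1 _] := g_spec (tau J h y).
have t := ln_g (tau J h y); rewrite /H -/x /free_energy.
have h3 : (ln x - ln (1 - x) / 2) * x = tau J h y * x by rewrite /x t.
rewrite /tau in h3; lra.
Qed.

(** [H y + 1] is the maximum over [x] of [free_energy x - J (x - y)^2]. At a
    maximizer [m] of [H] the optimal [x] is [m] itself, since moving [y] to [x]
    would gain [J (x - m)^2]. *)
Lemma H_maximizer J h m : 0 < J -> maximizer (H J h) m ->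
  [/\ 0 < m, m < 1, m = g (tau J h m), free_energy J h m = H J h m + 1 &
    forall x, 0 <= x -> x <= 1 -> free_energy J h x <= free_energy J h m].
Proof.
move=> J0 mm; have [g0 g1 _] := g_spec (tau J h m).
have E := H_free_energy J h m; rewrite /= in E.
set x := g (tau J h m) in g0 g1 E *.
have mx : x = m.
  have h1 := free_energy_le_H J h x (ltW g0) (ltW g1); rewrite subrr expr0n mulr0 subr0 in h1.
  have h2 := mm x.
  have h3 : J * (x - m) ^+ 2 <= 0 by lra.
  have h4 : (x - m) ^+ 2 <= 0 by rewrite -(pmulr_rle0 _ J0).
  apply/eqP; rewrite -subr_eq0 -sqrf_eq0 eq_le h4; exact: sqr_ge0.
rewrite mx in g0 g1 E *; rewrite subrr expr0n mulr0 subr0 in E.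
split=> // y y0 y1; have := free_energy_le_H J h y y0 y1.
by rewrite subrr expr0n mulr0 subr0 -E; have := mm y; lra.
Qed.

End legendre.

(** * Taylor expansion of the free energy *)

Definition free_energy1 (R : realType) (J h x : R) : R :=
  2 * J * x + h - J - ln x + ln (1 - x) / 2.

Definition free_energy2 (R : realType) (J x : R) : R :=
  2 * J - x^-1 - (2 * (1 - x))^-1.

Lemma is_derive_free_energy (R : realType) (J h x : R) : 0 < x -> x < 1 ->
  is_derive x 1 (free_energy J h) (free_energy1 J h x).
Proof.
move=> x0 x1; have h1 : 0 < 1 - x by rewrite subr_gt0.
rewrite /free_energy /free_energy1.
have dl := is_derive1_ln x0.
have dl1 : is_derive x 1 (fun y : R => ln (1 - y)) (- (1 - x)^-1).
  have dd : is_derive x 1 (fun y : R => 1 - y) (-1).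
    apply: is_derive_eq. ring.
  have := @is_derive1_comp R (@ln R) (fun y => 1 - y) x _ _ (is_derive1_ln h1) dd.
  by move=> H0; apply: is_derive_eq; rewrite mulrN1.
apply: is_derive_eq.
rewrite /GRing.scale /=. by field; rewrite !gt_eqF.
Qed.

Lemma is_derive_free_energy1 (R : realType) (J h x : R) : 0 < x -> x < 1 ->
  is_derive x 1 (free_energy1 J h) (free_energy2 J x).
Proof.
move=> x0 x1; have h1 : 0 < 1 - x by rewrite subr_gt0.
rewrite /free_energy1 /free_energy2.
have dl := is_derive1_ln x0.
have dl1 : is_derive x 1 (fun y : R => ln (1 - y)) (- (1 - x)^-1).
  have dd : is_derive x 1 (fun y : R => 1 - y) (-1).
    by apply: is_derive_eq; ring.
  have := @is_derive1_comp R (@ln R) (fun y => 1 - y) x _ _ (is_derive1_ln h1) dd.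
  by move=> H0; apply: is_derive_eq; rewrite mulrN1.
apply: is_derive_eq.
by rewrite /GRing.scale /=; field; rewrite !gt_eqF.
Qed.

(** The mean value theorem around [m], without a case distinction on the side. *)
Lemma MVT_point (R : realType) (F F' : R -> R) (e m x : R) :
  (forall y, `|y - m| <= e -> is_derive y 1 F (F' y)) -> `|x - m| <= e ->
  exists2 y, F x - F m = F' y * (x - m) & `|y - m| <= `|x - m|.
Proof.
move=> dF xe.
have bnd (a b : R) : a <= b -> `|a - m| <= e -> `|b - m| <= e -> forall y : R, a <= y -> y <= b -> `|y - m| <= e.
  move=> ab; rewrite !ler_norml => /andP[a1 a2] /andP[b1 b2] y y1 y2.
  by rewrite ler_norml; apply/andP; split; lra.
have seg (a b : R) : a <= b -> `|a - m| <= e -> `|b - m| <= e ->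
    exists2 c, (a <= c <= b) & F b - F a = F' c * (b - a).
  move=> ab ae be; have dd y : y \in `]a, b[ -> is_derive y 1 F (F' y).
    by rewrite in_itv /= => /andP[ay yb]; apply: dF; apply: (bnd a b) => //; exact: ltW.
  have [|c] := MVT_segment ab dd; last by rewrite in_itv /= => cab E; exists c.
  apply: derivable_within_continuous => y; rewrite in_itv /= => /andP[ay yb].
  by have [] := dF y (bnd a b ab ae be y ay yb).
have me : `|m - m| <= e by rewrite subrr normr0 (le_trans _ xe).
have [mx|xm] := leP m x.
- have [c /andP[c1 c2] E] := seg m x mx me xe; exists c => //.
  by rewrite !ger0_norm ?subr_ge0 //; lra.
- have [c /andP[c1 c2] E] := seg x m (ltW xm) xe me; exists c; first lra.
  by rewrite !ler0_norm ?subr_le0 ?(ltW xm) //; lra.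
Qed.

Lemma integrate_bound (R : realType) (F F' : R -> R) (e m K : R) (j : nat) : 0 <= K ->
  (forall y, `|y - m| <= e -> is_derive y 1 F (F' y)) ->
  (forall y, `|y - m| <= e -> `|F' y| <= K * `|y - m| ^+ j) ->
  forall x, `|x - m| <= e -> `|F x - F m| <= K * `|x - m| ^+ j.+1.
Proof.
move=> K0 dF bF x xe; have [y -> ym] := MVT_point dF xe.
rewrite normrM exprSr mulrA ler_wpM2r //.
apply: le_trans (bF _ (le_trans ym xe)) _; rewrite ler_wpM2l //.
by apply: lerXn2r; rewrite ?nnegrE.
Qed.

Lemma is_derive_shiftX (R : realType) (m y : R) (i : nat) :
  is_derive y 1 (fun z : R => (z - m) ^+ i.+1) (i.+1%:R * (y - m) ^+ i).
Proof.
have dd : is_derive y 1 (fun z : R => z - m) 1 by apply: is_derive_eq; ring.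
have := @is_deriveX R R (fun z => z - m) i.+1 y 1 1 dd.
rewrite (_ : (fun z : R => z - m) ^+ i.+1 = (fun z => (z - m) ^+ i.+1)); last first.
  by apply/funext => z; rewrite exprfctE.
by move=> H0; apply: is_derive_eq; rewrite /GRing.scale /= mulr1.
Qed.

(** Two integrations from the critical point [m] of a bound on the second
    derivative, which is a rational function and can be expanded exactly. *)
Lemma free_energy_taylor (R : realType) (J h m e a K : R) (i : nat) : 0 <= K ->
  e < m -> e < 1 - m -> free_energy1 J h m = 0 ->
  (forall x, `|x - m| <= e ->
    `|free_energy2 J x - i.+2%:R * i.+1%:R * a * (x - m) ^+ i| <= K * `|x - m| ^+ i.+1) ->
  forall x, `|x - m| <= e ->
    `|free_energy J h x - free_energy J h m - a * (x - m) ^+ i.+2| <= K * `|x - m| ^+ i.+3.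
Proof.
move=> K0 em e1m f1m bnd.
have inside y : `|y - m| <= e -> 0 < y /\ y < 1.
  by rewrite ler_norml => /andP[y1 y2]; split; lra.
pose G (y : R) := free_energy1 J h y - i.+2%:R * a * (y - m) ^+ i.+1.
pose F (y : R) := free_energy J h y - a * (y - m) ^+ i.+2.
have dG y : `|y - m| <= e -> is_derive y 1 G
    (free_energy2 J y - i.+2%:R * i.+1%:R * a * (y - m) ^+ i).
  move=> /inside[y0 y1]; have d1 := is_derive_free_energy1 J h y0 y1.
  have d2 := is_derive_shiftX m y i.
  by rewrite /G; apply: is_derive_eq; rewrite /GRing.scale /=; ring.
have dF y : `|y - m| <= e -> is_derive y 1 F (G y).
  move=> /inside[y0 y1]; have d1 := is_derive_free_energy J h y0 y1.
  have d2 := is_derive_shiftX m y i.+1.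
  by rewrite /F /G; apply: is_derive_eq; rewrite /GRing.scale /=; ring.
have Gm : G m = 0 by rewrite /G f1m subrr expr0n mulr0 subr0.
have bG y : `|y - m| <= e -> `|G y| <= K * `|y - m| ^+ i.+2.
  by move=> ye; have := integrate_bound K0 dG bnd ye; rewrite Gm subr0.
move=> x xe; have := integrate_bound K0 dF bG xe.
rewrite /F subrr expr0n mulr0 subr0.
by rewrite addrAC.
Qed.

Definition free_energy3 (R : realType) (x : R) : R := x ^- 2 - (2 * (1 - x) ^+ 2)^-1.
Definition free_energy4 (R : realType) (x : R) : R := - (2 * x ^- 3) - (1 - x) ^- 3.

(** Geometric expansions of [1/x] and [1/(1-x)] around [m], with exact
    remainder. *)
Lemma free_energy2_expand (R : realType) (J m : R) : 0 < m -> m < 1 ->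
  exists e K : R, [/\ 0 < e, e < m, e < 1 - m, 0 <= K & forall x, `|x - m| <= e ->
    `|free_energy2 J x - (free_energy2 J m + free_energy3 m * (x - m)
      + free_energy4 m / 2 * (x - m) ^+ 2)| <= K * `|x - m| ^+ 3].
Proof.
move=> m0 m1; have u0 : 0 < 1 - m by lra.
pose e := Num.min m (1 - m) / 2.
have em : e <= m / 2 by rewrite ler_pM2r // ge_min lexx.
have eu : e <= (1 - m) / 2 by rewrite ler_pM2r // ge_min lexx orbT.
have e0 : 0 < e by rewrite divr_gt0 // lt_min m0.
clearbody e.
exists e, ((m ^+ 3 * e)^-1 + ((1 - m) ^+ 3 * e)^-1).
have nn : 0 <= (m ^+ 3 * e)^-1 + ((1 - m) ^+ 3 * e)^-1.
  by rewrite addr_ge0 // invr_ge0 mulr_ge0 ?exprn_ge0 // ltW.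
split=> //; [lra | lra |] => x; rewrite ler_norml => /andP[x1 x2].
have xe : e <= x by lra.
have x1e : e <= 1 - x by lra.
have x0 : 0 < x by lra.
have x10 : 0 < 1 - x by lra.
rewrite (_ : _ - _ = (x - m) ^+ 3 * ((m ^+ 3 * x)^-1 - (2 * (1 - m) ^+ 3 * (1 - x))^-1)); last first.
  rewrite /free_energy2 /free_energy3 /free_energy4.
  by field; rewrite !gt_eqF.
rewrite normrM normrX mulrC ler_wpM2r ?exprn_ge0 //.
apply: le_trans (ler_normB _ _) _.
have p1 : 0 < m ^+ 3 by rewrite exprn_gt0.
have p2 : 0 < (1 - m) ^+ 3 by rewrite exprn_gt0.
rewrite !ger0_norm ?invr_ge0; last 2 first.
- by rewrite !mulr_ge0 // ltW.
- by rewrite mulr_ge0 // ltW.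
apply: lerD.
- by rewrite lef_pV2 ?posrE ?mulr_gt0 // ler_pM2l.
- rewrite lef_pV2 ?posrE ?mulr_gt0 // -mulrA.
  have := ler_wpM2l (ltW p2) x1e; have : 0 < (1 - m) ^+ 3 * (1 - x) by rewrite mulr_gt0.
  by lra.
Qed.

Lemma free_energy_taylor2 (R : realType) (J h m : R) : 0 < m -> m < 1 ->
  free_energy1 J h m = 0 ->
  exists e K : R, [/\ 0 < e, e < m, e < 1 - m, 0 <= K & forall x, `|x - m| <= e ->
    `|free_energy J h x - free_energy J h m - free_energy2 J m / 2 * (x - m) ^+ 2|
      <= K * `|x - m| ^+ 3].
Proof.
move=> m0 m1 f1; have [e [K [e0 em eu K0 hK]]] := free_energy2_expand J m0 m1.
pose K' := `|free_energy3 m| + `|free_energy4 m / 2| + K.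
have K'0 : 0 <= K' by rewrite !addr_ge0.
exists e, K'; split=> //; apply: (free_energy_taylor (i := 0)) => // x xe.
rewrite expr1 expr0 mulr1 (_ : 2 * 1 * _ = free_energy2 J m); last by field.
have d1 : `|x - m| <= 1 by lra.
set d := x - m in d1 hK xe *.
have := hK x xe; rewrite -/d => h1.
have -> : free_energy2 J x - free_energy2 J m =
  (free_energy2 J x - (free_energy2 J m + free_energy3 m * d + free_energy4 m / 2 * d ^+ 2)) +
  (free_energy3 m * d + free_energy4 m / 2 * d ^+ 2) by ring.
apply: le_trans (ler_normD _ _) _; rewrite /K' [leRHS]mulrDl [leRHS]addrC; apply: lerD.
  apply: le_trans h1 _; rewrite ler_wpM2l // exprS ler_piMr //.
  by apply: exprn_ile1.
apply: le_trans (ler_normD _ _) _; rewrite [leRHS]mulrDl normrM (normrM _ (d ^+ 2)) normrX; apply: lerD => //.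
by rewrite expr2 mulrA ler_piMr // mulr_ge0.
Qed.

Lemma free_energy_taylor3 (R : realType) (J h m : R) : 0 < m -> m < 1 ->
  free_energy1 J h m = 0 -> free_energy2 J m = 0 ->
  exists e K : R, [/\ 0 < e, e < m, e < 1 - m, 0 <= K & forall x, `|x - m| <= e ->
    `|free_energy J h x - free_energy J h m - free_energy3 m / 6 * (x - m) ^+ 3|
      <= K * `|x - m| ^+ 4].
Proof.
move=> m0 m1 f1 f2; have [e [K [e0 em eu K0 hK]]] := free_energy2_expand J m0 m1.
pose K' := `|free_energy4 m / 2| + K.
have K'0 : 0 <= K' by rewrite !addr_ge0.
exists e, K'; split=> //; apply: (free_energy_taylor (i := 1)) => // x xe.
rewrite expr1 (_ : 3 * 2 * _ = free_energy3 m); last by field.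
have d1 : `|x - m| <= 1 by lra.
set d := x - m in d1 hK xe *.
have := hK x xe; rewrite -/d f2 add0r => h1.
have -> : free_energy2 J x - free_energy3 m * d =
  (free_energy2 J x - (free_energy3 m * d + free_energy4 m / 2 * d ^+ 2)) +
  (free_energy4 m / 2 * d ^+ 2) by ring.
apply: le_trans (ler_normD _ _) _; rewrite /K' [leRHS]mulrDl [leRHS]addrC; apply: lerD.
  by apply: le_trans h1 _; rewrite ler_wpM2l // exprS ler_piMl // exprn_ge0.
by rewrite normrM normrX.
Qed.

Lemma free_energy_taylor4 (R : realType) (J h m : R) : 0 < m -> m < 1 ->
  free_energy1 J h m = 0 -> free_energy2 J m = 0 -> free_energy3 m = 0 ->
  exists e K : R, [/\ 0 < e, e < m, e < 1 - m, 0 <= K & forall x, `|x - m| <= e ->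
    `|free_energy J h x - free_energy J h m - free_energy4 m / 24 * (x - m) ^+ 4|
      <= K * `|x - m| ^+ 5].
Proof.
move=> m0 m1 f1 f2 f3; have [e [K [e0 em eu K0 hK]]] := free_energy2_expand J m0 m1.
exists e, K; split=> //; apply: (free_energy_taylor (i := 2)) => // x xe.
rewrite (_ : 4 * 3 * _ = free_energy4 m / 2); last by field.
by have := hK x xe; rewrite f2 f3 mul0r !add0r.
Qed.

(** At a maximum the first nonvanishing term of the Taylor expansion has even
    order and a negative coefficient. *)
Lemma free_energy2_max (R : realType) (J h m : R) : 0 < m -> m < 1 ->
  free_energy1 J h m = 0 ->
  (forall x, 0 <= x -> x <= 1 -> free_energy J h x <= free_energy J h m) ->
  free_energy2 J m <= 0 /\ (free_energy2 J m = 0 -> free_energy3 m = 0).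
Proof.
move=> m0 m1 f1 mx; split.
- have [e [K [e0 em eu K0 hK]]] := free_energy_taylor2 m0 m1 f1.
  rewrite leNgt; apply/negP => f2.
  set A := free_energy2 J m in f2 hK.
  pose d := Num.min e (A / 2 / (K + 1)) / 2.
  have d0 : 0 < d by rewrite divr_gt0 // lt_min e0 !divr_gt0 //; lra.
  have de : d <= e.
    have : d <= e / 2 by rewrite ler_pM2r // ge_min lexx.
    by lra.
  have dA : (K + 1) * d <= A / 2 / 2.
    have : d <= A / 2 / (K + 1) / 2 by rewrite ler_pM2r // ge_min lexx orbT.
    move=> /(ler_wpM2l (_ : 0 <= K + 1)) => /(_ ltac:(lra)) /le_trans; apply.
    rewrite le_eqVlt; apply/orP; left; apply/eqP; field; rewrite gt_eqF //; lra.
  have := hK (m + d); rewrite addrAC subrr add0r ger0_norm ?(ltW d0) // => /(_ de).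
  rewrite ler_norml => /andP[h1 _].
  have h2 := mx (m + d) ltac:(lra) ltac:(lra).
  have h3 : A / 2 * d ^+ 2 <= K * d ^+ 3 by lra.
  have d2 : 0 < d ^+ 2 by rewrite exprn_gt0.
  have h4 : A / 2 <= K * d by rewrite -(ler_pM2r d2) -[leRHS]mulrA -exprS.
  lra.
- move=> f2; have [e [K [e0 em eu K0 hK]]] := free_energy_taylor3 m0 m1 f1 f2.
  apply/eqP; apply: contraT => f3; exfalso.
  set A := free_energy3 m in f3 hK.
  have A0 : 0 < `|A| by rewrite normr_gt0.
  pose d := Num.min e (`|A| / 6 / (K + 1)) / 2.
  have d0 : 0 < d by rewrite divr_gt0 // lt_min e0 !divr_gt0 //; lra.
  have de : d <= e.
    have : d <= e / 2 by rewrite ler_pM2r // ge_min lexx.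
    by lra.
  have dA : (K + 1) * d <= `|A| / 6 / 2.
    have : d <= `|A| / 6 / (K + 1) / 2 by rewrite ler_pM2r // ge_min lexx orbT.
    move=> /(ler_wpM2l (_ : 0 <= K + 1)) => /(_ ltac:(lra)) /le_trans; apply.
    rewrite le_eqVlt; apply/orP; left; apply/eqP; field; rewrite gt_eqF //; lra.
  (* Moving from [m] in the direction of the sign of the third derivative
     increases the free energy. *)
  pose s : R := Num.sg A.
  have sn : `|s * d| = d by rewrite normrM normr_sg f3 mul1r ger0_norm // ltW.
  have := hK (m + s * d); rewrite addrAC subrr add0r sn => /(_ de).
  rewrite ler_norml => /andP[h1 _].
  have sd : `|s * d| <= d by rewrite sn.
  move: sd; rewrite ler_norml => /andP[s1 s2].
  have h2 := mx (m + s * d) ltac:(lra) ltac:(lra).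
  have E : A / 6 * (s * d) ^+ 3 = `|A| / 6 * d ^+ 3.
    have ss : s * s = 1 by rewrite -expr2 sqr_sg f3.
    rewrite [`|A|]normrEsg -/s exprMn; have -> : s ^+ 3 = s * (s * s) by ring.
    by rewrite ss mulr1; ring.
  have h3 : `|A| / 6 * d ^+ 3 <= K * d ^+ 4 by rewrite -E; lra.
  have d2 : 0 < d ^+ 3 by rewrite exprn_gt0.
  have h4 : `|A| / 6 <= K * d by rewrite -(ler_pM2r d2) -[leRHS]mulrA -exprS.
  lra.
Qed.

(** * Derivatives of H, and the critical point *)

(** The derivative of [g] is a function of the value of [g], which makes the
    higher derivatives of [H] rational functions of [g (tau J h x)]. *)
Definition g_slope (R : realType) (u : R) : R := 2 * u * (1 - u) / (2 - u).

Lemma is_derive_g (R : realType) (x : R) : is_derive x 1 (@g R) (g_slope (g x)).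
Proof.
have [g0 g1 gE] := g_spec x.
rewrite /g_slope; move: g0 g1 gE; rewrite /g => g0 g1 gE.
pose A (y : R) := expR (4 * y) + 4 * expR (2 * y).
have A0 : 0 < A x by rewrite addr_gt0 ?mulr_gt0 ?expR_gt0.
have de (a : R) : is_derive x 1 (fun y : R => expR (a * y)) (a * expR (a * x)).
  have dd : is_derive x 1 (fun y : R => a * y) a by apply: is_derive_eq; rewrite /GRing.scale /=; ring.
  have := @is_derive1_comp R (@expR R) (fun y => a * y) x _ _ (is_derive_expR _) dd.
  by move=> H0; apply: is_derive_eq; rewrite mulrC.
have dA : is_derive x 1 A (4 * expR (4 * x) + 8 * expR (2 * x)).
  have d4 := de 4; have d2 := de 2.
  by rewrite /A; apply: is_derive_eq; rewrite /GRing.scale /=; ring.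
have dS : is_derive x 1 (fun y => Num.sqrt (A y)) ((4 * expR (4 * x) + 8 * expR (2 * x)) / (2 * Num.sqrt (A x))).
  have := @is_derive1_comp R Num.sqrt A x _ _ (is_derive1_sqrt A0) dA.
  by move=> H0; apply: is_derive_eq; rewrite mulrC.
have d2 := de 2.
rewrite -/(A x) in g0 g1 gE *.
apply: is_derive_eq.
rewrite /GRing.scale /=.
set S := Num.sqrt (A x) in g0 g1 gE *.
have S0 : 0 < S by rewrite sqrtr_gt0.
have S2 : S ^+ 2 = A x by rewrite sqr_sqrtr // ltW.
have E4 : expR (4 * x) = expR (2 * x) ^+ 2 by rewrite -expRM_natl; congr expR; ring.
rewrite /A E4 in S2.
rewrite E4.
have E0 : 0 < expR (2 * x) by apply: expR_gt0.
set E := expR (2 * x) in g0 g1 gE S2 E0 *.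
have h1 : 4 + E - S != 0 by rewrite gt_eqF //; lra.
have h2 : 4 - S + E != 0 by rewrite gt_eqF //; lra.
rewrite [LHS](_ : _ = E * (E + 2 - S) / S); last by field; rewrite gt_eqF.
rewrite [RHS](_ : _ = (S - E) * (E + 2 - S) / (4 - S + E)); last by field.
apply/eqP; rewrite eqr_div //; last by rewrite gt_eqF.
have key : E * (4 - S + E) = S * (S - E) by rewrite !mulrBr -expr2 S2; ring.
by rewrite mulrAC key; apply/eqP; ring.
Qed.

Lemma is_derive_g_tau (R : realType) (J h x : R) :
  is_derive x 1 (fun y => g (tau J h y)) (2 * J * g_slope (g (tau J h x))).
Proof.
have dt : is_derive x 1 (tau J h) (2 * J).
  by rewrite /tau; apply: is_derive_eq; rewrite /GRing.scale /=; ring.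
have := @is_derive1_comp R (@g R) (tau J h) x _ _ (is_derive_g _) dt.
by move=> H0; apply: is_derive_eq; rewrite mulrC.
Qed.

Lemma is_derive_H (R : realType) (J h x : R) :
  is_derive x 1 (H J h) (2 * J * (g (tau J h x) - x)).
Proof.
have [g0 g1 _] := g_spec (tau J h x).
have dg := is_derive_g_tau J h x.
have h1 : 0 < 1 - g (tau J h x) by rewrite subr_gt0.
have dl : is_derive x 1 (fun y => ln (1 - g (tau J h y)))
    (- (2 * J * g_slope (g (tau J h x))) / (1 - g (tau J h x))).
  have dd : is_derive x 1 (fun y => 1 - g (tau J h y)) (- (2 * J * g_slope (g (tau J h x)))).
    by apply: is_derive_eq; ring.
  have := @is_derive1_comp R (@ln R) (fun y => 1 - g (tau J h y)) x _ _ (is_derive1_ln h1) dd.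
  by move=> H0; apply: is_derive_eq; rewrite mulrC.
rewrite /H; apply: is_derive_eq.
move: g0 g1 h1; rewrite /g_slope /GRing.scale /=; move: (g (tau J h x)) => u u0 u1 u2.
by field; rewrite !gt_eqF //; lra.
Qed.

Lemma derive1_H (R : realType) (J h : R) :
  derive1n 1 (H J h) = (fun x => 2 * J * (g (tau J h x) - x)).
Proof.
rewrite derive1n1; apply/funext => x; rewrite derive1E.
by have d := is_derive_H J h x; rewrite derive_val.
Qed.

Lemma derive2_H (R : realType) (J h : R) :
  derive1n 2 (H J h) = (fun x => 2 * J * (2 * J * g_slope (g (tau J h x)) - 1)).
Proof.
rewrite derive1nS derive1_H; apply/funext => x; rewrite derive1E.
have d := is_derive_g_tau J h x.
have dH : is_derive x 1 (fun x => 2 * J * (g (tau J h x) - x))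
    (2 * J * (2 * J * g_slope (g (tau J h x)) - 1)).
  by apply: is_derive_eq; rewrite /GRing.scale /=; ring.
exact: (@derive_val _ _ _ _ _ _ _ dH).
Qed.

Lemma is_derive_g_slope (R : realType) (u : R) : u < 1 ->
  is_derive u 1 (@g_slope R) ((4 - 8 * u + 2 * u ^+ 2) / (2 - u) ^+ 2).
Proof.
move=> u1; have u2 : 2 - u != 0 by rewrite gt_eqF //; lra.
have dv : is_derive u 1 (fun v : R => (2 - v)^-1) ((2 - u) ^- 2).
  have dd : is_derive u 1 (fun v : R => 2 - v) (-1) by apply: is_derive_eq; ring.
  have dv := @is_deriveV R (fun v : R => 2 - v) u (-1) 1 u2 dd.
  by apply: is_derive_eq; rewrite /GRing.scale /=; ring.
rewrite /g_slope; apply: is_derive_eq; rewrite /GRing.scale /=.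
by field.
Qed.

Definition g_slope1 (R : realType) (u : R) : R := (4 - 8 * u + 2 * u ^+ 2) / (2 - u) ^+ 2.

Lemma is_derive_g_slope1 (R : realType) (u : R) : u < 1 ->
  is_derive u 1 (@g_slope1 R) (- 8 / (2 - u) ^+ 3).
Proof.
move=> u1; have u2 : 2 - u != 0 by rewrite gt_eqF //; lra.
have dv : is_derive u 1 (fun v : R => ((2 - v) ^+ 2)^-1) (2 * (2 - u) ^- 3).
  have dd : is_derive u 1 (fun v : R => (2 - v) ^+ 2) (- 2 * (2 - u)).
    by apply: is_derive_eq; rewrite /GRing.scale /=; ring.
  have u22 : (2 - u) ^+ 2 != 0 by rewrite expf_neq0.
  have dv := @is_deriveV R (fun v : R => (2 - v) ^+ 2) u (- 2 * (2 - u)) 1 u22 dd.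
  by apply: is_derive_eq; rewrite /GRing.scale /=; field.
rewrite /g_slope1; apply: is_derive_eq; rewrite /GRing.scale /=.
by field.
Qed.

Lemma derive4_H (R : realType) (J h x : R) : let u := g (tau J h x) in
  derive1n 4 (H J h) x =
  16 * J ^+ 4 * g_slope u * (- 8 / (2 - u) ^+ 3 * g_slope u + g_slope1 u ^+ 2).
Proof.
have dS (y : R) : is_derive y 1 (fun y : R => g_slope (g (tau J h y)))
    (g_slope1 (g (tau J h y)) * (2 * J * g_slope (g (tau J h y)))).
  have [_ g1 _] := g_spec (tau J h y); have d := is_derive_g_tau J h y.
  have := @is_derive1_comp R (@g_slope R) (fun y => g (tau J h y)) y _ _ (is_derive_g_slope g1) d.
  by move=> H0; apply: is_derive_eq.
have dS1 (y : R) : is_derive y 1 (fun y : R => g_slope1 (g (tau J h y)))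
    (- 8 / (2 - g (tau J h y)) ^+ 3 * (2 * J * g_slope (g (tau J h y)))).
  have [_ g1 _] := g_spec (tau J h y); have d := is_derive_g_tau J h y.
  have := @is_derive1_comp R (@g_slope1 R) (fun y => g (tau J h y)) y _ _ (is_derive_g_slope1 g1) d.
  by move=> H0; apply: is_derive_eq.
have d3 : derive1n 3 (H J h) = (fun y => 8 * J ^+ 3 * (g_slope1 (g (tau J h y)) * g_slope (g (tau J h y)))).
  rewrite derive1nS derive2_H; apply/funext => y; rewrite derive1E.
  have d := dS y.
  have dH : is_derive y 1 (fun x => 2 * J * (2 * J * g_slope (g (tau J h x)) - 1))
      (8 * J ^+ 3 * (g_slope1 (g (tau J h y)) * g_slope (g (tau J h y)))).
    by apply: is_derive_eq; rewrite /GRing.scale /=; ring.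
  exact: (@derive_val _ _ _ _ _ _ _ dH).
move=> u; rewrite derive1nS d3 derive1E.
have d := dS x; have d1 := dS1 x.
have dH : is_derive x 1 (fun y => 8 * J ^+ 3 * (g_slope1 (g (tau J h y)) * g_slope (g (tau J h y))))
    (16 * J ^+ 4 * g_slope u * (- 8 / (2 - u) ^+ 3 * g_slope u + g_slope1 u ^+ 2)).
  by apply: is_derive_eq; rewrite /GRing.scale /= -/u; ring.
exact: (@derive_val _ _ _ _ _ _ _ dH).
Qed.

Lemma continuous_H (R : realType) (J h : R) : continuous (H J h).
Proof.
move=> x; have [d _] := is_derive_H J h x.
by apply: differentiable_continuous; apply/derivable1_diffP.
Qed.

Lemma H_maximizer_critical (R : realType) (J h m : R) : m = g (tau J h m) ->
  free_energy1 J h m = 0.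
Proof.
move=> mg; have := ln_g (tau J h m); rewrite -mg /tau /free_energy1; lra.
Qed.

(** [g] inverts the derivative of the entropy, so its slope is the inverse of the
    second derivative of the entropy. *)
Lemma free_energy2_slope (R : realType) (J m : R) : 0 < m -> m < 1 ->
  g_slope m = (2 * J - free_energy2 J m)^-1.
Proof.
move=> m0 m1; rewrite /g_slope /free_energy2; field.
by rewrite !gt_eqF //; lra.
Qed.

Section critical_point.
Variable R : realType.
Local Notation s := (Num.sqrt 2 : R).

Lemma sqrt2_bounds : [/\ 0 < s, s ^+ 2 = 2, 1 < s & s < 3 / 2].
Proof.
have s0 : 0 < s by rewrite sqrtr_gt0.
have ss : s ^+ 2 = 2 by rewrite sqr_sqrtr.
by split=> //; move: ss s0; rewrite expr2; nra.
Qed.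

Lemma m_crit_gt0 : 0 < m_crit R. Proof.
have [s0 ss s1 s2] := sqrt2_bounds.
by rewrite /m_crit; lra. Qed.
Lemma m_crit_lt1 : m_crit R < 1. Proof.
have [s0 ss s1 s2] := sqrt2_bounds.
by rewrite /m_crit; lra. Qed.

Lemma J_critE : J_crit R = (3 + 2 * s) / 4.
Proof.
have [s0 ss s1 s2] := sqrt2_bounds.
rewrite /J_crit; apply: (mulIf (x := 4 * (3 - 2 * s))); first by rewrite gt_eqF //; lra.
rewrite mulVf; last by rewrite gt_eqF //; lra.
by have := ss; rewrite expr2; lra.
Qed.

Lemma m_crit_inv : (m_crit R)^-1 = (2 + s) / 2.
Proof.
have [s0 ss s1 s2] := sqrt2_bounds.
rewrite /m_crit; apply: (mulIf (x := 2 - s)); first by rewrite gt_eqF //; lra.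
rewrite mulVf; last by rewrite gt_eqF //; lra.
by have := ss; rewrite expr2; lra.
Qed.

Lemma onem_crit_inv : (1 - m_crit R)^-1 = s + 1.
Proof.
have [s0 ss s1 s2] := sqrt2_bounds.
rewrite /m_crit; apply: (mulIf (x := 1 - (2 - s))); first by rewrite gt_eqF //; lra.
rewrite mulVf; last by rewrite gt_eqF //; lra.
by have := ss; rewrite expr2; lra.
Qed.

Lemma free_energy2_m_crit J : free_energy2 J (m_crit R) = 2 * (J - J_crit R).
Proof.
have [s0 ss s1 s2] := sqrt2_bounds.
by rewrite /free_energy2 invfM m_crit_inv onem_crit_inv J_critE; lra. Qed.

Lemma free_energy3_m_crit : free_energy3 (m_crit R) = 0.
Proof.
have [s0 ss s1 s2] := sqrt2_bounds.
rewrite /free_energy3 !expr2 !invfM m_crit_inv onem_crit_inv.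
by have := ss; rewrite !expr2; lra.
Qed.

(** The equation is [m^2 = 2 (1 - m)^2]. *)
Lemma free_energy3_eq0 m : 0 < m -> m < 1 -> free_energy3 m = 0 -> m = m_crit R.
Proof.
have [s0 ss s1 s2] := sqrt2_bounds.
move=> m0 m1 /eqP; rewrite /free_energy3 subr_eq0 => /eqP /(congr1 GRing.inv).
rewrite !invrK => E.
have : (m - s * (1 - m)) * (m + s * (1 - m)) = 0.
  have -> : (m - s * (1 - m)) * (m + s * (1 - m)) = m ^+ 2 - s ^+ 2 * (1 - m) ^+ 2 by ring.
  by rewrite ss; lra.
move/eqP; rewrite mulf_eq0 => /orP[|]/eqP F; last first.
  have : 0 < m + s * (1 - m) by rewrite addr_gt0 // mulr_gt0 // subr_gt0.
  by rewrite F ltxx.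
have sn : 1 + s != 0 by rewrite gt_eqF //; lra.
apply: (mulIf sn); rewrite /m_crit.
by have := ss; rewrite expr2; lra.
Qed.

Lemma free_energy1_crit : free_energy1 (J_crit R) (h_crit R) (m_crit R) = 0.
Proof.
have [s0 ss s1 s2] := sqrt2_bounds.
have m0 := m_crit_gt0; have m1 := m_crit_lt1.
have p1 : 0 < 2 * s - 2 by lra.
have p2 : 0 < 1 - m_crit R by lra.
have E : m_crit R ^+ 2 = (2 * s - 2) * (1 - m_crit R).
  by rewrite /m_crit; have := ss; rewrite !expr2; lra.
have := congr1 (@ln R) E; rewrite lnXn // lnM ?posrE // mulr2n => L.
have E2 : 2 * J_crit R * m_crit R - J_crit R = 4^-1.
  by rewrite J_critE /m_crit; have := ss; rewrite expr2; lra.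
rewrite /free_energy1 /h_crit; lra.
Qed.

(** At [J_crit] the numerator of the second derivative is, up to its sign, a
    multiple of [(x - m_crit)^2]. *)
Lemma free_energy2_crit_lt0 x : 0 < x -> x < 1 -> x != m_crit R ->
  free_energy2 (J_crit R) x < 0.
Proof.
have [s0 ss s1 s2] := sqrt2_bounds.
move=> x0 x1 xm.
have -> : free_energy2 (J_crit R) x = - ((3 + 2 * s) * (x - m_crit R) ^+ 2 / (2 * x * (1 - x))).
  rewrite /free_energy2 J_critE.
  rewrite [RHS](_ : _ = - (((3 + 2 * s) * x ^+ 2 - (4 + 2 * s) * x + 2) / (2 * x * (1 - x)))); last first.
    congr (- (_ / _)); rewrite /m_crit.
    have -> : (3 + 2 * s) * (x - (2 - s)) ^+ 2 =
       3 * x ^+ 2 + 2 * s * x ^+ 2 + (-12 - 2 * s + 4 * s ^+ 2) * x + 12 - 4 * s - 5 * s ^+ 2 + 2 * s * s ^+ 2 by ring.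
    by rewrite ss; ring.
  by field; rewrite !gt_eqF //; lra.
rewrite oppr_lt0 divr_gt0 //; last by rewrite !mulr_gt0 // subr_gt0.
apply: mulr_gt0; first lra.
by rewrite lt_neqAle sqr_ge0 andbT eq_sym sqrf_eq0 subr_eq0.
Qed.

Lemma free_energy1_crit_eq0 m : 0 < m -> m < 1 ->
  free_energy1 (J_crit R) (h_crit R) m = 0 -> m = m_crit R.
Proof.
have [s0 ss s1 s2] := sqrt2_bounds.
move=> m0 m1 f1; apply/eqP; apply: contraT => ne; exfalso.
have c0 := m_crit_gt0; have c1 := m_crit_lt1.
have key a b : 0 < a -> b < 1 -> a < b ->
    (forall c, a < c -> c < b -> c != m_crit R) ->
    free_energy1 (J_crit R) (h_crit R) b < free_energy1 (J_crit R) (h_crit R) a.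
  move=> a0 b1 ab nc.
  have dd c : a <= c -> c <= b -> is_derive c 1 (free_energy1 (J_crit R) (h_crit R)) (free_energy2 (J_crit R) c).
    by move=> ac cb; apply: is_derive_free_energy1; lra.
  have [||c] := @MVT R (free_energy1 (J_crit R) (h_crit R)) (free_energy2 (J_crit R)) a b ab.
  - by move=> c; rewrite in_itv /= => /andP[ac cb]; apply: dd; exact: ltW.
  - apply: derivable_within_continuous => c; rewrite in_itv /= => /andP[ac cb].
    by have [] := dd c ac cb.
  - rewrite in_itv /= => /andP[ac cb] E.
    have : free_energy2 (J_crit R) c * (b - a) < 0.
      rewrite nmulr_rlt0 ?subr_gt0 //; apply: free_energy2_crit_lt0; [lra | lra | exact: nc].
    by rewrite -E subr_lt0.
have := free_energy1_crit; case: (ltgtP m (m_crit R)) ne => // lt _ f1c.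
- have nc c : m < c -> c < m_crit R -> c != m_crit R by move=> _ cm; rewrite lt_eqF.
  by have := key _ _ m0 c1 lt nc; rewrite f1 f1c ltxx.
- have nc c : m_crit R < c -> c < m -> c != m_crit R by move=> mc _; rewrite gt_eqF.
  by have := key _ _ c0 m1 lt nc; rewrite f1 f1c ltxx.
Qed.

(** If the second derivative vanished at the maximum, so would the third, which
    forces [m = m_crit]; then the vanishing of the second and of the first
    derivative force [J = J_crit] and [h = h_crit]. *)
Lemma H_critical_point (J h m : R) : 0 < J -> maximizer (H J h) m ->
  (J, h) <> (J_crit R, h_crit R) -> free_energy2 J m < 0.
Proof.
have [s0 ss s1 s2] := sqrt2_bounds.
move=> J0 mm nc; have [m0 m1 mg _ mx] := H_maximizer J0 mm.
have f1 := H_maximizer_critical mg.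
have [f2 f3] := free_energy2_max m0 m1 f1 mx.
rewrite lt_neqAle f2 andbT; apply/eqP => f20; apply: nc.
have mE := free_energy3_eq0 m0 m1 (f3 f20).
have JE : J = J_crit R by move: f20; rewrite mE free_energy2_m_crit; lra.
congr pair => //; have := free_energy1_crit; move: f1.
by rewrite JE mE /free_energy1; lra.
Qed.

(** The variance defined through [H] is the one of the Gaussian approximation of
    [expR (n * free_energy)]. *)
Lemma lambda0E (J h m : R) : 0 < J -> maximizer (H J h) m -> free_energy2 J m < 0 ->
  lambda0 J h m = - (free_energy2 J m)^-1.
Proof.
have [s0 ss s1 s2] := sqrt2_bounds.
move=> J0 mm f2; have [m0 m1 mg _ _] := H_maximizer J0 mm.
rewrite /lambda0 derive2_H -mg (free_energy2_slope J m0 m1).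
move: f2; move: (free_energy2 J m) => f f0.
by field; apply/and3P; split; [rewrite lt_eqF | rewrite gt_eqF | rewrite gt_eqF //; lra].
Qed.

Lemma crit_maximizer (m : R) : 0 < J_crit R ->
  maximizer (H (J_crit R) (h_crit R)) m -> m = m_crit R.
Proof.
have [s0 ss s1 s2] := sqrt2_bounds.
move=> J0 mm; have [m0 m1 mg _ _] := H_maximizer J0 mm.
by apply: free_energy1_crit_eq0 => //; exact: H_maximizer_critical.
Qed.

(** As the derivatives of order two and three vanish at the critical point, the
    fourth derivatives of [H] and of the free energy agree there. *)
Lemma lambda_critE : maximizer (H (J_crit R) (h_crit R)) (m_crit R) ->
  lambda_crit R = - free_energy4 (m_crit R) /\ 0 < lambda_crit R.
Proof.
have [s0 ss s1 s2] := sqrt2_bounds.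
have J0 : 0 < J_crit R by rewrite J_critE; lra.
move=> mm; have [m0 m1 mg _ _] := H_maximizer J0 mm.
have L : lambda_crit R = - free_energy4 (m_crit R).
  rewrite /lambda_crit derive4_H -mg (free_energy2_slope (J_crit R) m0 m1) free_energy2_m_crit.
  rewrite subrr mulr0 subr0.
  have -> : g_slope1 (m_crit R) = 0.
    by rewrite /g_slope1 /m_crit; have := ss; rewrite expr2 => h2; apply/eqP; rewrite mulf_eq0; apply/orP; left; apply/eqP; lra.
  have -> : 2 - m_crit R = s by rewrite /m_crit; ring.
  rewrite expr0n addr0 /free_energy4 -!exprVn m_crit_inv onem_crit_inv.
  rewrite [X in - X = _](_ : _ = - (4 * J_crit R ^+ 2 * (8 / s ^+ 3))); last first.
    by field; rewrite !gt_eqF.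
  have -> : 8 / s ^+ 3 = 2 * s.
    have s3 : s ^+ 3 = 2 * s by rewrite exprS ss mulrC.
    rewrite s3; apply: (mulIf (x := 2 * s)); first by rewrite gt_eqF //; lra.
    rewrite divfK; last by rewrite gt_eqF //; lra.
    by have := ss; rewrite expr2; lra.
  rewrite J_critE.
  have s2' : s * s = 2 by rewrite -expr2.
  have s3 : s * (s * s) = 2 * s by rewrite s2' mulrC.
  by rewrite !exprS !expr0; lra.
split=> //; rewrite L /free_energy4 opprB opprK addr_gt0 ?mulr_gt0 //.
- by rewrite invr_gt0 exprn_gt0 // subr_gt0.
- by rewrite invr_gt0 exprn_gt0.
Qed.

End critical_point.

(** [H] is continuous on the whole line, so compactness is applied to [H], which
    dominates the free energy and has the same maximum; the free energy itself
    is not differentiable at the end points of [[0, 1]]. *)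
Lemma free_energy_gap (R : realType) (J h m e : R) : 0 < J -> 0 < e ->
  maximizer (H J h) m -> (forall m', maximizer (H J h) m' -> m' = m) ->
  exists2 eta : R, 0 < eta & forall x, 0 <= x -> x <= 1 -> e <= `|x - m| ->
    free_energy J h x <= free_energy J h m - eta.
Proof.
move=> J0 e0 mm uniq.
have cH a b : {within `[a, b], continuous (H J h)}.
  by apply: continuous_subspaceT; exact: continuous_H.
have [m0 m1 _ fm _] := H_maximizer J0 mm.
have gap a b : (forall x, a <= x -> x <= b -> x != m) ->
    exists2 eta : R, 0 < eta & forall x, a <= x -> x <= b -> H J h x <= H J h m - eta.
  move=> nm; have [ab|ba] := leP a b; last by exists 1 => // x ax xb; lra.
  have [c] := EVT_max ab (cH a b); rewrite in_itv /= => /andP[ac cb] cmax.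
  exists (H J h m - H J h c).
    rewrite subr_gt0 lt_neqAle mm andbT; apply/eqP => E.
    have : maximizer (H J h) c by move=> x; rewrite E.
    by move/uniq/eqP; apply/negP; exact: nm.
  by move=> x ax xb; have := cmax x; rewrite in_itv /= ax xb => /(_ isT); lra.
have [|e1 e10 h1] := gap 0 (m - e); first by move=> x _ xe; rewrite lt_eqF //; lra.
have [|e2 e20 h2] := gap (m + e) 1; first by move=> x xe _; rewrite gt_eqF //; lra.
exists (Num.min e1 e2); first by rewrite lt_min e10.
have le1 : Num.min e1 e2 <= e1 by rewrite ge_min lexx.
have le2 : Num.min e1 e2 <= e2 by rewrite ge_min lexx orbT.
move=> x x0 x1; have := free_energy_le_H J h x x0 x1.
rewrite subrr expr0n mulr0 subr0 ler_normr => hx /orP[xe|xe].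
- have mx : m + e <= x by lra.
  by have := h2 x mx x1; lra.
- have xm : x <= m - e by lra.
  by have := h1 x x0 xm; lra.
Qed.

(** * Local approximation of the weights *)

Lemma stirling_gap_diff (R : realType) (a : R) (k l : nat) : 0 < a ->
  a <= k.+1%:R -> a <= l.+1%:R ->
  `|stirling_gap R k - stirling_gap R l| <= `|k%:R - l%:R| / a.
Proof.
move=> a0; wlog lk : k l / (l <= k)%N.
  move=> W ak al; case: (leqP l k) => [lk|/ltnW kl]; first exact: W.
  by rewrite distrC (distrC k%:R); apply: W.
move=> ak al; have /andP[h1 h2] := stirling_gap_lip R lk.
rewrite !ger0_norm ?subr_ge0 ?ler_nat //; last by rewrite -subr_ge0.
apply: le_trans h2 _; rewrite ler_wpM2l ?subr_ge0 ?ler_nat //.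
by rewrite lef_pV2 ?posrE ?ltr0n.
Qed.

(** The logarithm of the weight that would be found at the density [m] itself,
    where neither [n * m] nor [n * (1 - m) / 2] need be integers. *)
Definition reference_log (R : realType) (J h m : R) (n : nat) : R :=
  ln n`!%:R - n%:R / 2 * ln n%:R + n%:R * free_energy J h m
  - stirling_gap R (Num.truncn (n%:R * m)) - stirling_gap R (Num.truncn (n%:R * (1 - m) / 2)).

Lemma truncn_bounds (R : realType) (x : R) : 0 <= x ->
  (Num.truncn x)%:R <= x /\ x < (Num.truncn x).+1%:R.
Proof. by move=> x0; have /andP[] := Num.Theory.truncn_itv x0. Qed.

(** With [y = X (k/n - m)] and [X ^ r = n], the Taylor remainder contributes
    [n |y/X| ^ (r+1) = |y| ^ (r+1) / X] to the exponent, and the variation of the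
    two Stirling gaps contributes [O(|k/n - m| + 1/n)], which is
    [O((1 + |y|) / X)]. *)
Lemma weight_bulk (R : realType) (J h m c e K : R) (p : nat) :
  0 < m -> m < 1 -> 0 <= K -> e < m -> e < 1 - m ->
  (forall x, `|x - m| <= e ->
    `|free_energy J h x - free_energy J h m + c * `|x - m| ^+ p.+2| <= K * `|x - m| ^+ p.+3) ->
  exists2 K' : R, 0 < K' & forall (n k d : nat) (X : R), (0 < n)%N -> 1 <= X ->
    X ^+ p.+2 = n%:R -> (k + d.*2 = n)%N -> `|k%:R / n%:R - m| <= e ->
    exists2 E : R, monomer_dimer_weight J h n k d = expR (reference_log J h m n) *
       expR (- (c * `|X * (k%:R / n%:R - m)| ^+ p.+2)) * expR E &
      `|E| <= K' / X * (1 + `|X * (k%:R / n%:R - m)| ^+ p.+3).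
Proof.
move=> m0 m1 K0 em eu taylor.
pose a := m - e; have aE : a = m - e by [].
pose b := 1 - m - e; have bE : b = 1 - m - e by [].
clearbody a b.
have a0 : 0 < a by lra.
have b0 : 0 < b by lra.
exists (K + 2 / a + 3 / b).
  by rewrite addr_gt0 ?divr_gt0 // ltr_wpDl ?divr_gt0.
move=> n k d X n0 X1 Xn kdn xe.
have e0 : 0 <= e := le_trans (normr_ge0 _) xe.
have nR : 0 < n%:R :> R by rewrite ltr0n.
set x := k%:R / n%:R in xe *.
have X0 : 0 < X by lra.
have nx : n%:R * x = k%:R by rewrite /x mulrCA divff ?mulr1 // gt_eqF.
have nE : n%:R = k%:R + 2 * d%:R :> R by rewrite -kdn natrD -muln2 natrM mulrC.
have n1x : n%:R * (1 - x) = 2 * d%:R by rewrite mulrBr nx mulr1 nE; ring.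
set k' := Num.truncn (n%:R * m); set d' := Num.truncn (n%:R * (1 - m) / 2).
have [k1 k2] : k'%:R <= n%:R * m /\ n%:R * m < k'.+1%:R.
  by apply: truncn_bounds; rewrite mulr_ge0 // ltW.
have [d1 d2] : d'%:R <= n%:R * (1 - m) / 2 /\ n%:R * (1 - m) / 2 < d'.+1%:R.
  by apply: truncn_bounds; rewrite !mulr_ge0 // subr_ge0 ltW.
pose E := n%:R * (free_energy J h x - free_energy J h m + c * `|x - m| ^+ p.+2)
  - (stirling_gap R k - stirling_gap R k') - (stirling_gap R d - stirling_gap R d').
have nX t : n%:R * `|t| ^+ p.+2 = `|X * t| ^+ p.+2.
  by rewrite normrM exprMn (ger0_norm (ltW X0)) Xn.
exists E.
  rewrite monomer_dimer_weightE // -/x -!expRD /E /reference_log -/k' -/d' -nX; congr expR.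
  by ring.
have [x1 x2] : m - e <= x /\ x <= m + e.
  by move: xe; rewrite ler_norml => /andP[]; lra.
set y := `|X * (x - m)|.
have y0 : 0 <= y by apply: normr_ge0.
have yE : `|x - m| = y / X by rewrite /y normrM (ger0_norm (ltW X0)) mulrAC divff ?mul1r // gt_eqF.
have nX1 : X <= n%:R by rewrite -Xn exprS ler_peMr ?exprn_ege1 // ltW.
have invn : n%:R^-1 <= X^-1 :> R by rewrite lef_pV2 ?posrE.
set Q := 1 + y ^+ p.+3.
have Q1 : 1 <= Q by rewrite lerDl exprn_ge0.
have yQ : y <= Q.
  have [l1|g1] := leP y 1; first lra.
  have : y <= y ^+ p.+3 by rewrite -[leLHS]expr1; apply: ler_weXn2l => //; exact: ltW.
  by rewrite /Q; lra.
have T1 : `|n%:R * (free_energy J h x - free_energy J h m + c * `|x - m| ^+ p.+2)| <= K / X * Q.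
  rewrite normrM ger0_norm; last exact: ltW.
  apply: le_trans (ler_wpM2l (ltW nR) (taylor x xe)) _.
  have -> : n%:R * (K * `|x - m| ^+ p.+3) = K / X * y ^+ p.+3.
    rewrite yE -Xn expr_div_n (exprSr X p.+2).
    have Xp0 : X ^+ p.+2 != 0 by rewrite expf_neq0 // gt_eqF.
    move: Xp0; move: (X ^+ p.+2) (y ^+ p.+3) => Xp yp Xp0.
    by field; rewrite Xp0 gt_eqF.
  rewrite ler_wpM2l //; first by rewrite divr_ge0 // ltW.
  by rewrite /Q lerDr.
have T2 : `|stirling_gap R k - stirling_gap R k'| <= 2 / a / X * Q.
  have na : 0 < n%:R * a by rewrite mulr_gt0.
  have h1 : n%:R * a <= k.+1%:R.
    rewrite aE -natr1 -nx; have := ler_wpM2l (ltW nR) x1; lra.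
  have h2 : n%:R * a <= k'.+1%:R.
    by apply: le_trans (ltW k2); rewrite ler_pM2l // aE; lra.
  apply: le_trans (stirling_gap_diff na h1 h2) _.
  have h3 : `|k%:R - k'%:R| <= n%:R * (y / X) + 1.
    rewrite -yE -{1}nx.
    have -> : n%:R * x - k'%:R = n%:R * (x - m) + (n%:R * m - k'%:R) by ring.
    apply: le_trans (ler_normD _ _) _; rewrite normrM (ger0_norm (ltW nR)) lerD2l.
    by rewrite -natr1 in k2; rewrite ler_norml; apply/andP; split; lra.
  apply: le_trans (ler_wpM2r _ h3) _; first by rewrite invr_ge0 ltW.
  have -> : (n%:R * (y / X) + 1) / (n%:R * a) = (y / X + n%:R^-1) / a by field; rewrite !gt_eqF.
  have -> : 2 / a / X * Q = 2 * Q / X / a by field; rewrite !gt_eqF.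
  rewrite ler_wpM2r ?invr_ge0 ?(ltW a0) //.
  have : y / X <= Q / X by rewrite ler_wpM2r ?invr_ge0 ?(ltW X0).
  have : 1 / X <= Q / X by rewrite ler_wpM2r ?invr_ge0 ?(ltW X0).
  by lra.
have T3 : `|stirling_gap R d - stirling_gap R d'| <= 3 / b / X * Q.
  have nb : 0 < n%:R * b / 2 by rewrite divr_gt0 // mulr_gt0.
  have h1 : n%:R * b / 2 <= d.+1%:R.
    have bx : b <= 1 - x by lra.
    have := ler_wpM2l (ltW nR) bx; rewrite n1x => nbd.
    by rewrite -(natr1 d); lra.
  have h2 : n%:R * b / 2 <= d'.+1%:R.
    have bm : b <= 1 - m by lra.
    by apply: le_trans (ltW d2); rewrite ler_wpM2r ?invr_ge0 // ler_wpM2l // ltW.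
  apply: le_trans (stirling_gap_diff nb h1 h2) _.
  have h3 : `|d%:R - d'%:R| <= n%:R * (y / X) / 2 + 1.
    rewrite -yE (_ : d%:R = n%:R * (1 - x) / 2); last by rewrite n1x; field.
    have -> : n%:R * (1 - x) / 2 - d'%:R = - (n%:R / 2 * (x - m)) + (n%:R * (1 - m) / 2 - d'%:R) by field.
    apply: le_trans (ler_normD _ _) _; rewrite normrN normrM (@ger0_norm _ (n%:R / 2)); last first.
      by rewrite divr_ge0 // ltW.
    rewrite mulrAC lerD2l.
    by rewrite -(natr1 d') in d2; rewrite ler_norml; apply/andP; split; lra.
  apply: le_trans (ler_wpM2r _ h3) _; first by rewrite invr_ge0 ltW.
  have -> : (n%:R * (y / X) / 2 + 1) / (n%:R * b / 2) = (y / X + 2 * n%:R^-1) / b by field; rewrite !gt_eqF.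
  have -> : 3 / b / X * Q = 3 * Q / X / b by field; rewrite !gt_eqF.
  rewrite ler_wpM2r ?invr_ge0 ?(ltW b0) //.
  have : y / X <= Q / X by rewrite ler_wpM2r ?invr_ge0 ?(ltW X0).
  have : 1 / X <= Q / X by rewrite ler_wpM2r ?invr_ge0 ?(ltW X0).
  by lra.
rewrite /E; apply: le_trans (ler_normB _ _) _.
have -> : (K + 2 / a + 3 / b) / X * Q = K / X * Q + 2 / a / X * Q + 3 / b / X * Q by ring.
apply: lerD => //; apply: le_trans (ler_normB _ _) _; exact: lerD.
Qed.

(** The Stirling gaps are logarithmic in [n], hence negligible against
    [n * eta]. *)
Lemma weight_far (R : realType) (J h m e eta : R) :
  0 < m -> m < 1 -> 0 < eta ->
  (forall x, 0 <= x -> x <= 1 -> e <= `|x - m| ->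
     free_energy J h x <= free_energy J h m - eta) ->
  exists2 Kf : R, 0 < Kf & forall (n k d : nat), (0 < n)%N ->
    (k + d.*2 = n)%N -> e <= `|k%:R / n%:R - m| ->
    monomer_dimer_weight J h n k d <=
      expR (reference_log J h m n) * (Kf * expR (- (eta / 2 * n%:R))).
Proof.
move=> m0 m1 eta0 gap.
exists (expR 2 * (16 / eta ^+ 2)); first by rewrite mulr_gt0 ?expR_gt0 // divr_gt0 // exprn_gt0.
move=> n k d n0 kdn xe; rewrite monomer_dimer_weightE //.
have nR : 0 < n%:R :> R by rewrite ltr0n.
set x := k%:R / n%:R in xe *.
have x0 : 0 <= x by rewrite divr_ge0.
have x1 : x <= 1 by rewrite ler_pdivrMr // mul1r ler_nat -kdn leq_addr.
have hf := ler_wpM2l (ltW nR) (gap x x0 x1 xe).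
have g1 := stirling_gap_ge0 R k; have g2 := stirling_gap_ge0 R d.
have g3 : stirling_gap R (Num.truncn (n%:R * m)) <= 1 + ln n%:R.
  apply: stirling_gap_le => //; rewrite -(ler_nat R).
  have [h1 _] := truncn_bounds (mulr_ge0 (ltW nR) (ltW m0)).
  by apply: le_trans h1 _; rewrite ler_piMr // ltW.
have g4 : stirling_gap R (Num.truncn (n%:R * (1 - m) / 2)) <= 1 + ln n%:R.
  apply: stirling_gap_le => //; rewrite -(ler_nat R).
  have nn : 0 <= n%:R * (1 - m) / 2 by rewrite !mulr_ge0 // subr_ge0 ltW.
  have [h1 _] := truncn_bounds nn.
  apply: le_trans h1 _; rewrite -mulrA ler_piMr //; lra.
apply: (@le_trans _ _ (expR (reference_log J h m n + (2 + 2 * ln n%:R - eta * n%:R)))).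
  by rewrite ler_expR /reference_log; lra.
rewrite expRD ler_wpM2l ?expR_ge0 //.
rewrite (_ : 2 + 2 * ln n%:R - eta * n%:R = 2 + 2 * ln n%:R - eta / 2 * n%:R + (- (eta / 2 * n%:R))); last by field.
rewrite expRD ler_wpM2r ?expR_ge0 // -addrA expRD ler_wpM2l ?expR_ge0 //.
rewrite expRD expRM_natl lnK ?posrE // expRN ler_pdivrMr ?expR_gt0 //.
have h1 : 0 <= eta * n%:R / 4 by rewrite !mulr_ge0 // ltW.
have := expr_le_expR 2 h1.
rewrite (_ : 2 * (eta * n%:R / 4) = eta / 2 * n%:R); last by field.
move=> h2; rewrite mulrAC ler_pdivlMr ?exprn_gt0 //.
have -> : n%:R ^+ 2 * eta ^+ 2 = 16 * (eta * n%:R / 4) ^+ 2 by field.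
by rewrite ler_pM2l.
Qed.

(** * Sums of the weights over the lattice *)

Lemma initial_segment (P : pred nat) (M : nat) : (forall d, P d.+1 -> P d) ->
  exists2 N, (N <= M)%N & forall d, (d < M)%N -> P d = (d < N)%N.
Proof.
move=> Pd; elim: M => [|M [N NM IH]]; first by exists 0%N.
have [PM|nPM] := boolP (P M).
- exists M.+1 => // d; rewrite ltnS => dM; rewrite dM.
  have : forall i, (i <= M)%N -> P (M - i)%N.
    elim=> [|i IHi] iM; first by rewrite subn0.
    by apply: Pd; rewrite -subSn // subSS; apply: IHi; exact: ltnW.
  by move=> /(_ _ (leq_subr d M)); rewrite subKn.
- exists N; first exact: leqW.
  move=> d; rewrite ltnS leq_eqVlt => /predU1P[->|]; last exact: IH.
  by rewrite (negbTE nPM) ltnNge NM.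
Qed.

Lemma sum_initial_segment (R : realType) (M N : nat) (P : pred nat) (F : nat -> R) :
  (N <= M)%N -> (forall d, (d < M)%N -> P d = (d < N)%N) ->
  \sum_(d < M | P d) F d = \sum_(i < N) F (N - i.+1)%N.
Proof.
move=> NM PN; rewrite (eq_bigl (fun d : 'I_M => (d < N)%N)); last by move=> d; exact: PN.
by rewrite (big_ord_narrow NM) (reindex_inj rev_ord_inj).
Qed.

Lemma sum_split_segment (R : realType) (M N : nat) (F : nat -> R) : (N <= M)%N ->
  \sum_(d < M) F d = \sum_(i < N) F (N - i.+1)%N + \sum_(i < M - N) F (N + i)%N.
Proof.
move=> NM; move: (M - N)%N (subnKC NM) => k <-; rewrite big_split_ord /=; congr (_ + _).
by rewrite (reindex_inj rev_ord_inj).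
Qed.

Lemma double_le_half (n d : nat) : (d < n./2.+1)%N -> (d.*2 <= n)%N.
Proof. lia. Qed.

Lemma half_bounds (n : nat) : (0 < n)%N ->
  [/\ (n <= 2 * n./2.+1)%N, (n <= 1 + 2 * n./2)%N & (n./2.+1 <= n)%N].
Proof. by move=> n0; split; lia. Qed.

Section tail_ratio.
Variables (R : realType) (J h m c : R) (p : nat).
Hypotheses (c0 : (0 : R) < c) (m0 : (0 : R) < m) (m1 : m < (1 : R)).
Hypothesis ep : ~~ odd p.
Hypothesis taylor : exists e K : R, [/\ 0 < e, e < m, e < 1 - m, 0 <= K & forall x : R, `|x - m| <= e ->
    `|free_energy J h x - free_energy J h m + c * (x - m) ^+ p.+2| <= K * `|x - m| ^+ p.+3].
Hypothesis gap : forall e : R, 0 < e -> exists2 eta : R, 0 < eta &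
  forall x, 0 <= x -> x <= 1 -> e <= `|x - m| ->
    free_energy J h x <= free_energy J h m - eta.

Local Notation I := (power_tail c p).

(** The rescaled magnetization with [d] dimers, decreasing in [d] with step
    [2 X / n]. *)
Definition lattice_point (n : nat) (X : R) (d : nat) : R :=
  X * ((n%:R - 2 * d%:R) / n%:R - m).

(** Weights normalized so as to approximate [power_exp c p] times the lattice
    spacing. *)
Definition scaled_weight (n : nat) (X : R) (d : nat) : R :=
  monomer_dimer_weight J h n (n - d.*2) d / expR (reference_log J h m n) * (2 * X / n%:R).

Lemma lattice_pointE n X d : (d.*2 <= n)%N ->
  lattice_point n X d = X * ((n - d.*2)%:R / n%:R - m).
Proof. by move=> dn; rewrite /lattice_point natrB // -muln2 natrM (mulrC d%:R). Qed.

Lemma scaled_weight_estimate : exists e K eta Kf : R,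
  [/\ 0 < e, e < m, e < 1 - m & 0 < K] /\ [/\ 4 * K * e <= c, 0 < eta, eta <= c / 2 * e ^+ p.+2 & 0 < Kf] /\
  forall (n : nat) (X : R) (d : nat), (0 < n)%N -> 1 <= X -> X ^+ p.+2 = n%:R -> (d.*2 <= n)%N ->
    let y := `|lattice_point n X d| in
    (y <= e * X -> exists2 E : R,
       scaled_weight n X d = 2 * X / n%:R * power_exp c p y * expR E &
       `|E| <= K / X * (1 + y ^+ p.+3)) /\
    (e * X < y -> `|scaled_weight n X d| <= 2 * X / n%:R * (Kf * expR (- (eta * X ^+ 2)))).
Proof.
have [e1 [K1 [e10 e1m e1u K10 hT]]] := taylor.
have hT' x : `|x - m| <= e1 ->
    `|free_energy J h x - free_energy J h m + c * `|x - m| ^+ p.+2| <= K1 * `|x - m| ^+ p.+3.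
  move=> xe; rewrite -normrX (@ger0_norm _ ((x - m) ^+ p.+2)); first exact: hT.
  by apply: exprn_even_ge0; rewrite /= negbK.
have [K K0 bulk] := weight_bulk m0 m1 K10 e1m e1u hT'.
pose e := Num.min e1 (c / (4 * K)).
have e0 : 0 < e by rewrite lt_min e10 divr_gt0 // mulr_gt0.
have ee1 : e <= e1 by rewrite ge_min lexx.
have eK : 4 * K * e <= c.
  have h1 : e <= c / (4 * K) by rewrite ge_min lexx orbT.
  by rewrite mulrC -ler_pdivlMr // mulr_gt0.
have [eta1 eta10 hgap] := gap e0.
have [Kf Kf0 far] := weight_far m0 m1 eta10 hgap.
pose eta := Num.min (eta1 / 2) (c / 2 * e ^+ p.+2).
have eta0 : 0 < eta.
  by rewrite lt_min divr_gt0 //= mulr_gt0 ?exprn_gt0 // divr_gt0.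
exists e, K, eta, Kf; split; first by split=> //; [exact: le_lt_trans ee1 e1m | exact: le_lt_trans ee1 e1u].
split; first by split=> //; rewrite ge_min lexx orbT.
move=> n X d n0 X1 Xn dn; rewrite lattice_pointE //.
have X0 : 0 < X by apply: lt_le_trans X1.
have nR : 0 < n%:R :> R by rewrite ltr0n.
have D0 : 0 <= 2 * X / n%:R by rewrite !mulr_ge0 ?invr_ge0 // ltW.
have kdn : (n - d.*2 + d.*2 = n)%N by rewrite subnK.
set x := (n - d.*2)%:R / n%:R.
have yE : `|X * (x - m)| = X * `|x - m| by rewrite normrM (ger0_norm (ltW X0)).
have rl : expR (reference_log J h m n) != 0 by rewrite gt_eqF // expR_gt0.
split.
- rewrite {1}yE mulrC ler_pM2r // => xe.
  have [E wE bE] := bulk n _ d X n0 X1 Xn kdn (le_trans xe ee1).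
  exists E => //; rewrite /scaled_weight /power_exp wE.
  by field; rewrite rl gt_eqF.
- rewrite {1}yE mulrC ltr_pM2l // => xe.
  have w0 : 0 <= monomer_dimer_weight J h n (n - d.*2) d by rewrite monomer_dimer_weightE // expR_ge0.
  have hf := far n _ d n0 kdn (ltW xe).
  rewrite /scaled_weight ger0_norm; last first.
    by rewrite mulr_ge0 // divr_ge0 ?expR_ge0.
  rewrite [leRHS]mulrC ler_wpM2r //.
  rewrite ler_pdivrMr ?expR_gt0 // [leRHS]mulrC; apply: le_trans hf _.
  rewrite ler_wpM2l ?expR_ge0 // ler_wpM2l ?(ltW Kf0) // ler_expR lerN2.
  have h1 : X ^+ 2 <= n%:R by rewrite -Xn; apply: ler_weXn2l.
  apply: ler_pM => //; [exact: ltW | by rewrite exprn_ge0 // ltW | by rewrite ge_min lexx].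
Qed.

(** The tail above [z] is an arithmetic progression starting within one step of
    [z], so [lattice_tail] applies. For the total mass it is applied with [z = 0]
    to the positive points and to the reflected nonpositive ones. The conditions
    on [X] ensure that the lattice reaches beyond [z] and on both sides
    of [m]. *)
Lemma scaled_weight_sums : exists2 C : R, 0 < C & exists2 X0 : R, 1 <= X0 &
  forall (n : nat) (X z : R), (0 < n)%N -> X0 <= X -> X ^+ p.+2 = n%:R -> 0 <= z -> z ^+ p.+3 <= X ->
   `|\sum_(d < n./2.+1 | z < lattice_point n X d) scaled_weight n X d - I z| <= C / X * (1 + z) ^+ p.+3 * I z /\
   `|\sum_(d < n./2.+1) scaled_weight n X d - 2 * I 0| <= C / X * (2 * I 0).
Proof.
have [e [K [eta [Kf [[e0 em eu K0] [[eK eta0 etae Kf0] est]]]]]] := scaled_weight_estimate.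
have [KI KI0 hKI] := power_tail_bound c0 ep.
have I0 z := power_tail_ge0 c p z.
have Id := power_tail_diff c0 ep.
have [C C0 tail] := lattice_tail c0 I0 Id hKI K0 e0 eK eta0 etae Kf0 KI0.
exists C => //.
pose X0 := 1 + 1 / m + 1 / (1 - m) ^+ 2 + 1 / (1 - m).
have u0 : 0 < 1 - m by rewrite subr_gt0.
have a1 : 0 < 1 / m by rewrite divr_gt0.
have a2 : 0 < 1 / (1 - m) ^+ 2 by rewrite divr_gt0 // exprn_gt0.
have a3 : 0 < 1 / (1 - m) by rewrite divr_gt0.
exists X0; first by rewrite /X0; lra.
move=> n X z n0 XX Xn z0 zX.
have X1 : 1 <= X by rewrite /X0 in XX; lra.
have X0' : 0 < X by lra.
have Xm : 1 < X * m by rewrite -ltr_pdivrMr //; rewrite /X0 in XX; lra.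
have Xu : 1 < X * (1 - m) by rewrite -ltr_pdivrMr //; rewrite /X0 in XX; lra.
have Xu2 : 1 < X * (1 - m) ^+ 2 by rewrite -ltr_pdivrMr ?exprn_gt0 //; rewrite /X0 in XX; lra.
have nR : 0 < n%:R :> R by rewrite ltr0n.
have nX1 : X <= n%:R by rewrite -Xn exprS ler_peMr ?exprn_ege1 // ltW.
set M := n./2.+1.
pose D : R := 2 * X / n%:R.
have D0 : 0 < D by rewrite divr_gt0 // mulr_gt0.
have DX : D * X ^+ p.+1 = 2 by rewrite /D -Xn exprS; field; rewrite expf_neq0 ?gt_eqF.
pose y := lattice_point n X.
have yS d : y d.+1 = y d - D.
  by rewrite /y /lattice_point /D -natr1; field; rewrite gt_eqF.
have yD d i : y (d + i)%N = y d - i%:R * D.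
  by rewrite /y /lattice_point /D natrD; field; rewrite gt_eqF.
have y0E : y 0%N = X * (1 - m).
  by rewrite /y /lattice_point mulr0 subr0 divff // gt_eqF.
have dM d : (d < M)%N -> (d.*2 <= n)%N by apply: double_le_half.
have [M1 M2 M3] := half_bounds n0.
have yM : y M <= - (X * m).
  have hM : n%:R - 2 * M%:R <= 0 :> R.
    by rewrite subr_le0 -natrM ler_nat.
  have : (n%:R - 2 * M%:R) / n%:R <= 0 :> R by rewrite pmulr_lle0 // invr_gt0.
  move=> hh; rewrite /y /lattice_point mulrBr gerDr.
  by rewrite pmulr_rle0.
have yM1 : y n./2 < 0.
  have hM : n%:R - 2 * (n./2)%:R <= 1 :> R.
    by move: M2; rewrite -(ler_nat R) natrD natrM; lra.
  have : (n%:R - 2 * (n./2)%:R) / n%:R < m.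
    rewrite ltr_pdivrMr //; apply: le_lt_trans hM _; apply: lt_le_trans Xm _.
    by rewrite mulrC ler_pM2l.
  by move=> hh; rewrite /y /lattice_point pmulr_rlt0 // subr_lt0.
(* The points above [z'] are those of index less than some [N], read in reverse
   order to be increasing. *)
have seg z' : exists2 N, (N <= M)%N & forall d, (d < M)%N -> (z' < y d) = (d < N)%N.
  apply: initial_segment => d; rewrite yS => h1; apply: lt_le_trans h1 _.
  by rewrite gerBl ltW.
have right_sum z' N : 0 <= z' -> z' ^+ p.+3 <= X -> (N <= M)%N ->
    (forall d, (d < M)%N -> (z' < y d) = (d < N)%N) ->
    `|\sum_(i < N) scaled_weight n X (N - i.+1)%N - I z'| <= C / X * (1 + z') ^+ p.+3 * I z'.
  move=> z'0 z'X NM hN.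
  (* [z' ^ 2 <= X], whereas the largest lattice point grows like [X]. *)
  have zy0 : z' < y 0%N.
    rewrite y0E; have [z1|z1] := leP z' 1; first exact: le_lt_trans z1 Xu.
    have z2 : z' ^+ 2 <= z' ^+ p.+3 by apply: ler_weXn2l => //; exact: ltW.
    rewrite -ltr_sqr ?nnegrE //; last by rewrite mulr_ge0 // ltW.
    apply: le_lt_trans (le_trans z2 z'X) _.
    by rewrite exprMn expr2 -mulrA -[ltLHS]mulr1 ltr_pM2l.
  have N0 : (0 < N)%N by rewrite -hN.
  case: N N0 NM hN => // N _ NM hN.
  have NltM : (N.+1 < M)%N.
    rewrite ltn_neqAle NM andbT; apply/eqP => E.
    have := hN n./2; rewrite /M ltnSn => /(_ isT); rewrite E /M ltnSn => /lt_trans.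
    by move=> /(_ _ yM1); rewrite ltNge z'0.
  apply: (tail X z' (y N) D N.+1 (fun i => scaled_weight n X (N.+1 - i.+1)%N)) => //.
  - exact: ltW.
  - by apply: ltW; rewrite hN.
  - by have := hN N.+1 NltM; rewrite ltnn yS => /negbT; rewrite -leNgt lerBlDr.
  - have : y 0%N = y N + N%:R * D by have := yD 0%N N; rewrite add0n => ->; rewrite subrK.
    rewrite y0E -natr1 mulrDl mul1r addrA => <-.
    apply: (@le_trans _ _ (X * (1 - m))); last by rewrite lerDl ltW.
    by rewrite mulrC ler_pM2l // ltW.
  - rewrite Xn; apply: (@le_trans _ _ n%:R); last by lra.
    by rewrite ler_nat (leq_trans NM).
  - move=> i; rewrite ltnS => iN hy.
    have yi : y (N.+1 - i.+1)%N = y N + i%:R * D.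
      by rewrite subSS; have := yD (N - i)%N i; rewrite subnK // => ->; rewrite subrK.
    have yi0 : 0 <= y N + i%:R * D.
      apply: addr_ge0; last by rewrite mulr_ge0 // ltW.
      by apply: le_trans z'0 _; apply: ltW; rewrite hN.
    have dn : ((N.+1 - i.+1).*2 <= n)%N by apply: dM; rewrite subSS; apply: leq_ltn_trans (leq_subr _ _) (ltnW NltM).
    have [+ _] := est n X _ n0 X1 Xn dn; rewrite -/(y _) yi ger0_norm //.
    by move=> /(_ hy).
  - move=> i; rewrite ltnS => iN hy.
    have yi : y (N.+1 - i.+1)%N = y N + i%:R * D.
      by rewrite subSS; have := yD (N - i)%N i; rewrite subnK // => ->; rewrite subrK.
    have yi0 : 0 <= y N + i%:R * D.
      apply: addr_ge0; last by rewrite mulr_ge0 // ltW.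
      by apply: le_trans z'0 _; apply: ltW; rewrite hN.
    have dn : ((N.+1 - i.+1).*2 <= n)%N by apply: dM; rewrite subSS; apply: leq_ltn_trans (leq_subr _ _) (ltnW NltM).
    have [_ +] := est n X _ n0 X1 Xn dn; rewrite -/(y _) yi ger0_norm //.
    by move=> /(_ hy).
split.
  have [N NM hN] := seg z.
  rewrite (sum_initial_segment (P := fun d => z < lattice_point n X d) _ NM hN).
  exact: right_sum.
have [N NM hN] := seg 0.
have z00 : (0 : R) ^+ p.+3 <= X by rewrite expr0n /= ltW.
have hR := right_sum 0 N (lexx 0) z00 NM hN.
have NltM : (N < M)%N.
  rewrite ltn_neqAle NM andbT; apply/eqP => E.
  have := hN n./2; rewrite /M ltnSn => /(_ isT); rewrite E /M ltnSn => /lt_trans.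
  by move=> /(_ _ yM1); rewrite ltxx.
have N0 : (0 < N)%N by rewrite -hN // y0E mulr_gt0.
(* The points below or at [0] are reflected, starting from the first of them. *)
have hL : `|\sum_(i < M - N) scaled_weight n X (N + i)%N - I 0| <= C / X * (1 + 0) ^+ p.+3 * I 0.
  have yN : y N <= 0 by have := hN N NltM; rewrite ltnn => /negbT; rewrite -leNgt.
  apply: (tail X 0 (- y N) D (M - N)%N (fun i => scaled_weight n X (N + i)%N)) => //.
  - exact: ltW.
  - by rewrite oppr_ge0.
  - rewrite add0r lerNl; have : 0 < y N.-1 by by rewrite hN ?prednK // (leq_ltn_trans (leq_pred _)).
    by have := yS N.-1; rewrite prednK // => ->; rewrite lerBrDl addrN => /ltW.
  - have E : y M = y N - (M - N)%:R * D by rewrite -yD subnKC.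
    have : e * X <= X * m by rewrite mulrC ler_pM2l // ltW.
    by rewrite E in yM; lra.
  - rewrite Xn; apply: (@le_trans _ _ (2 * n)%:R); last by rewrite natrM.
    by rewrite ler_nat (leq_trans (leq_subr _ _)) // (leq_trans M3) // leq_pmull.
  - move=> i iN hy.
    have yi : `|y (N + i)%N| = - y N + i%:R * D.
      rewrite ler0_norm yD; first by rewrite opprB addrC.
      by rewrite subr_le0 (le_trans yN) // mulr_ge0 // ltW.
    have dn : ((N + i).*2 <= n)%N by apply: dM; rewrite -ltn_subRL.
    by have [+ _] := est n X _ n0 X1 Xn dn; rewrite -/(y _) yi => /(_ hy).
  - move=> i iN hy.
    have yi : `|y (N + i)%N| = - y N + i%:R * D.
      rewrite ler0_norm yD; first by rewrite opprB addrC.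
      by rewrite subr_le0 (le_trans yN) // mulr_ge0 // ltW.
    have dn : ((N + i).*2 <= n)%N by apply: dM; rewrite -ltn_subRL.
    by have [_ +] := est n X _ n0 X1 Xn dn; rewrite -/(y _) yi => /(_ hy).
rewrite (sum_split_segment _ NM).
rewrite (_ : _ - _ = (\sum_(i < N) scaled_weight n X (N - i.+1)%N - I 0) +
  (\sum_(i < M - N) scaled_weight n X (N + i)%N - I 0)); last by ring.
apply: le_trans (ler_normD _ _) _; move: hR hL; rewrite addr0 expr1n mulr1 => hR hL.
have -> : C / X * (2 * I 0) = C / X * I 0 + C / X * I 0 by ring.
exact: lerD.
Qed.

End tail_ratio.

(** * The tail ratio *)

Lemma power_tail_gt0 (R : realType) (c : R) (p : nat) (z : R) :
  0 < c -> ~~ odd p -> 0 <= z -> 0 < power_tail c p z.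
Proof.
move=> c0 ep z0.
have [k k0 hk] := tail_minorant c0 (power_tail_ge0 c p) (power_tail_diff c0 ep).
apply: lt_le_trans (hk z z0); rewrite mulr_gt0 // divr_gt0 ?expR_gt0 //.
by rewrite ltr_pwDl // exprn_ge0.
Qed.

Lemma gibbs_prob_scaled (R : realType) (J h m X : R) (n : nat) (P : R -> bool) : (0 < n)%N -> 0 < X ->
  gibbs_prob J h (fun s : config n => P (X * (magnetization R s - m))) =
  (\sum_(d < n./2.+1 | P (lattice_point m n X d)) scaled_weight J h m n X d) /
  (\sum_(d < n./2.+1) scaled_weight J h m n X d).
Proof.
move=> n0 X0; rewrite (gibbs_probE n J h (fun x => P (X * (x - m)))) /scaled_weight.
set r := expR _; have r0 : r != 0 by rewrite gt_eqF // expR_gt0.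
have s0 : 2 * X / n%:R != 0 by rewrite gt_eqF // divr_gt0 ?mulr_gt0 // ltr0n.
rewrite -!mulr_suml -mulf_div divff // mulr1 -mulf_div divff ?invr_eq0 // mulr1.
congr (_ / _); apply: eq_bigl => d; rewrite lattice_pointE //.
exact: double_le_half.
Qed.

Lemma gibbs_prob_itv (R : realType) (J h : R) (n : nat) (P : R -> bool) :
  0 <= gibbs_prob J h (fun s : config n => P (magnetization R s)) <= 1.
Proof.
rewrite gibbs_probE.
have w0 (d : 'I_n./2.+1) : 0 <= monomer_dimer_weight J h n (n - d.*2) d.
  by rewrite /monomer_dimer_weight mulr_ge0 ?expR_ge0 // divr_ge0 // !mulr_ge0 // exprn_ge0.
have Z0 : 0 <= \sum_(d < n./2.+1) monomer_dimer_weight J h n (n - d.*2) d by apply: sumr_ge0.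
have S0 : 0 <= \sum_(d < n./2.+1 | P ((n - d.*2)%:R / n%:R)) monomer_dimer_weight J h n (n - d.*2) d.
  exact: sumr_ge0.
rewrite divr_ge0 //=; move: Z0; rewrite le_eqVlt => /predU1P[<-|Z0]; first by rewrite invr0 mulr0.
rewrite ler_pdivrMr // mul1r [leRHS](bigID (fun d : 'I_n./2.+1 => P ((n - d.*2)%:R / n%:R))) /=.
by rewrite lerDl sumr_ge0.
Qed.

(** Quotient of the two estimates of [scaled_weight_sums]. They hold for large
    [n]; for the others [z <= X] is bounded, hence the tail of the limiting law is
    bounded below and the constant can be enlarged. *)
Lemma gibbs_tail_ratio (R : realType) (J h m c : R) (p : nat) :
  0 < c -> 0 < m -> m < 1 -> ~~ odd p ->
  (exists e K : R, [/\ 0 < e, e < m, e < 1 - m, 0 <= K & forall x : R, `|x - m| <= e ->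
    `|free_energy J h x - free_energy J h m + c * (x - m) ^+ p.+2| <= K * `|x - m| ^+ p.+3]) ->
  (forall e : R, 0 < e -> exists2 eta : R, 0 < eta &
    forall x, 0 <= x -> x <= 1 -> e <= `|x - m| ->
    free_energy J h x <= free_energy J h m - eta) ->
  exists C : R, forall (n : nat) (X z : R), (0 < n)%N -> 0 <= X -> X ^+ p.+2 = n%:R ->
    0 <= z -> z ^+ p.+3 <= X ->
    `|gibbs_prob J h (fun s : config n => z < X * (magnetization R s - m))
      / (power_tail c p z / (2 * power_tail c p 0)) - 1| <= C * X^-1 * (1 + z ^+ p.+3).
Proof.
move=> c0 m0 m1 ep taylor gap.
have [C0 C00 [X0 X01 est]] := scaled_weight_sums c0 m0 m1 ep taylor gap.
pose X1 := X0 + 2 * C0.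
have I00 : 0 < power_tail c p 0 by apply: power_tail_gt0.
have X1p : 0 < X1 by rewrite /X1; lra.
have IX1 : 0 < power_tail c p X1 by apply: power_tail_gt0 => //; exact: ltW.
pose B := 2 * power_tail c p 0 / power_tail c p X1 + 1.
have B0 : 0 < B by rewrite addr_gt0 // divr_gt0 // mulr_gt0.
exists (4 * C0 * 2 ^+ p.+3 + B * X1) => n X z n0 Xge0 Xn z0 zX.
have Xge1 : 1 <= X.
  rewrite leNgt; apply/negP => Xlt; have : X ^+ p.+2 < 1 by rewrite exprn_ilt1.
  by rewrite Xn ltNge ler1n n0.
have Xp : 0 < X by apply: lt_le_trans Xge1.
have zp : 0 <= z ^+ p.+3 by apply: exprn_ge0.
have Iz : 0 < power_tail c p z by apply: power_tail_gt0.
have iX : 0 < X^-1 by rewrite invr_gt0.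
have q1 : 0 <= 4 * C0 * 2 ^+ p.+3 * X^-1 * (1 + z ^+ p.+3).
  by nneg.
have q2 : 0 <= B * X1 * X^-1 * (1 + z ^+ p.+3).
  by nneg.
have -> : (4 * C0 * 2 ^+ p.+3 + B * X1) * X^-1 * (1 + z ^+ p.+3) =
  4 * C0 * 2 ^+ p.+3 * X^-1 * (1 + z ^+ p.+3) + B * X1 * X^-1 * (1 + z ^+ p.+3) by ring.
have [XX1|XX1] := leP X1 X; last first.
  apply: le_trans (_ : _ <= B) _; last first.
    apply: (@le_trans _ _ (B * X1 * X^-1 * (1 + z ^+ p.+3))); last by rewrite lerDr.
    rewrite -[leLHS]mulr1 -!mulrA ler_pM2l // mulrA.
    have h1 : 1 <= X1 * X^-1 by rewrite ler_pdivlMr // mul1r ltW.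
    by rewrite -[leLHS]mulr1; apply: ler_pM => //; rewrite lerDl.
  have /andP[P0 P1] := gibbs_prob_itv J h n (fun x => z < X * (x - m)).
  set P := gibbs_prob _ _ _ in P0 P1 *.
  have zX1 : z <= X1.
    apply: le_trans (ltW XX1); have [z1|z1] := leP z 1; first exact: le_trans z1 Xge1.
    by apply: le_trans zX; rewrite -[leLHS]expr1; apply: ler_weXn2l => //; exact: ltW.
  have hI : power_tail c p X1 <= power_tail c p z.
    by apply: (tail_anti (power_tail_diff c0 ep)).
  have ge : 0 <= P / (power_tail c p z / (2 * power_tail c p 0)).
    by rewrite divr_ge0 // divr_ge0 ?(ltW Iz) // mulr_ge0 // ltW.
  have le : P / (power_tail c p z / (2 * power_tail c p 0)) <= 2 * power_tail c p 0 / power_tail c p X1.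
    rewrite invf_div mulrA -[leRHS]mulrA.
    rewrite -[leRHS]mul1r -mulrA; apply: ler_pM => //.
      by rewrite divr_ge0 ?(ltW Iz) // mulr_ge0 // ltW.
    rewrite mulrA ler_wpM2l ?mulr_ge0 ?(ltW I00) //.
    by rewrite lef_pV2 ?posrE.
  rewrite /B ler_norml; apply/andP; split; lra.
have X0X : X0 <= X by rewrite /X1 in XX1; lra.
have [hS hZ] := est n X z n0 X0X Xn z0 zX.
rewrite (gibbs_prob_scaled J h m (fun y => z < y) n0 Xp).
set S := \sum_(d < _ | _) _ in hS *; set Z := \sum_(d < _) _ in hZ *.
set u := power_tail c p z in Iz hS *; set v := power_tail c p 0 in I00 hZ *.
set w := (1 + z) ^+ p.+3 in hS.
have w1 : 1 <= w by rewrite /w exprn_ege1 // lerDl.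
have wle : w <= 2 ^+ p.+3 * (1 + z ^+ p.+3) by apply: expr1D_le.
have CX : C0 / X <= 1 / 2.
  by rewrite ler_pdivrMr //; rewrite /X1 in XX1; lra.
have CX0 : 0 < C0 / X by rewrite divr_gt0.
have Zv : v <= Z.
  move: hZ; rewrite ler_norml => /andP[h1 _].
  have : C0 / X * (2 * v) <= 1 / 2 * (2 * v) by rewrite ler_pM2r // mulr_gt0.
  by clearbody v Z; lra.
have Z0 : 0 < Z by apply: lt_le_trans Zv.
have -> : S / Z / (u / (2 * v)) - 1 = (2 * v * (S - u) - u * (Z - 2 * v)) / (Z * u).
  by field; rewrite !gt_eqF.
rewrite normrM normfV (ger0_norm (ltW (mulr_gt0 Z0 Iz))) ler_pdivrMr ?mulr_gt0 //.
apply: le_trans (ler_normB _ _) _; rewrite !normrM (ger0_norm (ltW Iz)) (ger0_norm (ltW I00)).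
rewrite (@ger0_norm _ 2) //.
have e1 : 2 * v * `|S - u| <= 2 * v * (C0 / X * w * u) by rewrite ler_pM2l // mulr_gt0.
have e2 : u * `|Z - 2 * v| <= u * (C0 / X * (2 * v)) by rewrite ler_pM2l.
have e3 : u * (C0 / X * (2 * v)) <= 2 * v * (C0 / X * w * u).
  have -> : 2 * v * (C0 / X * w * u) = u * (C0 / X * (2 * v)) * w by ring.
  by rewrite ler_peMr //; nneg.
apply: (@le_trans _ _ (4 * (C0 / X) * w * (v * u))).
  by apply: le_trans (lerD e1 (le_trans e2 e3)) _; rewrite le_eqVlt; apply/orP; left; apply/eqP; ring.
apply: ler_pM.
- have w0 : 0 <= w := le_trans ler01 w1.
  by nneg.
- by rewrite mulr_ge0 // ltW.
- apply: (@le_trans _ _ (4 * C0 * 2 ^+ p.+3 * X^-1 * (1 + z ^+ p.+3))); last by rewrite lerDl.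
  have -> : 4 * C0 * 2 ^+ p.+3 * X^-1 * (1 + z ^+ p.+3) = 4 * (C0 / X) * (2 ^+ p.+3 * (1 + z ^+ p.+3)) by ring.
  by rewrite ler_pM2l // mulr_gt0.
- by rewrite ler_pM2r.
Qed.

Unset Implicit Arguments.

Theorem theorem3p2 (R : realType) (gamma : R -> R)
  (hgamma : coexistence_curve gamma) (J h : R) (hJ : 0 < J) :
  (forall m0 : R, maximizer (H J h) m0 ->
     ~ (Gamma gamma `|` [set (J_crit R, h_crit R)]) (J, h) ->
     0 < lambda0 J h m0 /\
     exists C : R, forall (n : nat) (z : R), (0 < n)%N ->
       0 <= z <= n%:R `^ (1 / 6) ->
       `| gibbs_prob J h
            (fun s : config n => z < n%:R `^ (1 / 2) * (magnetization R s - m0))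
          / normal_tail (lambda0 J h m0) z - 1 |
       <= C * n%:R `^ (- (1 / 2)) * (1 + z ^+ 3)) /\
  ((J, h) = (J_crit R, h_crit R) ->
     0 < lambda_crit R /\
     exists C : R, forall (n : nat) (z : R), (0 < n)%N ->
       0 <= z <= n%:R `^ (1 / 20) ->
       `| gibbs_prob J h
            (fun s : config n =>
               z < n%:R `^ (1 / 4) * (magnetization R s - m_crit R))
          / quartic_tail (lambda_crit R) z - 1 |
       <= C * n%:R `^ (- (1 / 4)) * (1 + z ^+ 5)).
Proof.
(* With [X = n ^ (1/a)] the range of [z] is exactly [z ^ b <= X]. *)
have root (n a b : nat) (z : R) : (0 < a)%N -> (0 < b)%N -> 0 <= z <= n%:R `^ (1 / (a * b)%:R) ->
    [/\ 0 <= n%:R `^ (1 / a%:R) :> R, (n%:R `^ (1 / a%:R)) ^+ a = n%:R :> R,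
        0 <= z & z ^+ b <= n%:R `^ (1 / a%:R)].
  move=> a0 b0 /andP[z0 zn]; split=> //; rewrite ?powR_ge0 //.
    by rewrite -powR_mulrn ?powR_ge0 // -powRrM div1r mulVf ?powRr1 // pnatr_eq0 -lt0n.
  apply: (@le_trans _ _ ((n%:R `^ (1 / (a * b)%:R)) ^+ b)).
    by apply: lerXn2r; rewrite ?nnegrE // powR_ge0.
  rewrite -powR_mulrn ?powR_ge0 // -powRrM !div1r natrM invfM -mulrA mulVf ?mulr1 //.
  by rewrite pnatr_eq0 -lt0n.
split.
- move=> m0 mm nGc.
  have nG : ~ Gamma gamma (J, h) by move=> G; apply: nGc; left.
  have nc : (J, h) <> (J_crit R, h_crit R) by move=> E; apply: nGc; right.
  have [m1 [m1m uniq]] := (hgamma.2 J h hJ).1 nG.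
  have uniq0 m' : maximizer (H J h) m' -> m' = m0 by move=> /uniq <-; exact: uniq.
  have [p0 p1 mg _ _] := H_maximizer hJ mm.
  have f1 := H_maximizer_critical mg.
  have f2 := H_critical_point hJ mm nc.
  have L := lambda0E hJ mm f2.
  have L0 : 0 < lambda0 J h m0 by rewrite L oppr_gt0 invr_lt0.
  split=> //.
  have c0 : 0 < (2 * lambda0 J h m0)^-1 by rewrite invr_gt0 mulr_gt0.
  have [||C hC] := @gibbs_tail_ratio R J h m0 _ 0 c0 p0 p1 isT.
  + have [e [K [e0 em eu K0 hK]]] := free_energy_taylor2 p0 p1 f1.
    exists e, K; split=> // x xe.
    have -> : (2 * lambda0 J h m0)^-1 = - (free_energy2 J m0 / 2).
      by rewrite L; field; rewrite lt_eqF.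
    by rewrite mulNr; exact: hK.
  + by move=> e e0; exact: free_energy_gap.
  exists C => n z n0 hz.
  have [X0 Xn z0 zX] := root n 2%N 3%N z isT isT hz.
  by rewrite normal_tailE // powRN; exact: hC.
- move=> E; have [JE hE] : J = J_crit R /\ h = h_crit R by case: E.
  have nG : ~ Gamma gamma (J, h) by rewrite JE => -[/=]; rewrite ltxx.
  have [m1 [m1m uniq]] := (hgamma.2 J h hJ).1 nG.
  subst J h.
  have mE := crit_maximizer hJ m1m.
  subst m1.
  have [L L0] := lambda_critE m1m.
  split=> //.
  have [p0 p1 mg _ _] := H_maximizer hJ m1m.
  have f1 := H_maximizer_critical mg.
  have f2 : free_energy2 (J_crit R) (m_crit R) = 0 by rewrite free_energy2_m_crit subrr mulr0.
  have f3 := free_energy3_m_crit R.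
  have c0 : 0 < lambda_crit R / 24 by rewrite divr_gt0.
  have [||C hC] := @gibbs_tail_ratio R (J_crit R) (h_crit R) (m_crit R) _ 2 c0 p0 p1 isT.
  + have [e [K [e0 em eu K0 hK]]] := free_energy_taylor4 p0 p1 f1 f2 f3.
    exists e, K; split=> // x xe; rewrite L mulNr mulNr; exact: hK.
  + by move=> e e0; apply: free_energy_gap => // m' /uniq.
  exists C => n z n0 hz.
  have [X0 Xn z0 zX] := root n 4%N 5%N z isT isT hz.
  by rewrite quartic_tailE // powRN; exact: hC.
Qed.
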